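(* Let $n\geq 2$ and let $\Sigma^n$ be a submanifold isometrically immersed in a Riemannian manifold $\overline{M}^m$. Then, for all $X\in\mathfrak{X}(\Sigma)$, $$\operatorname{Ric}(X,X)\geq-\frac{n-1}{n}\left(S+\frac{n(n-2)}{\sqrt{n(n-1)}}H\sqrt{S-nH^{2}}-2nH^2\right)|X|^{2}+\sum_{i=1}^n\langle\overline{R}(X,e_{i})X,e_{i}\rangle,$$ where $\operatorname{Ric}$ is the Ricci curvature of $\Sigma^n$ and $\{e_1,\dots,e_n\}$ is a local orthonormal frame of tangent fields on $\Sigma^n$.
   Context: $\mathfrak{X}(\Sigma)$ is the set of tangent vector fields on $\Sigma^n$. $\overline{R}$ is the curvature tensor of $\overline{M}^m$, with the sign convention that $\langle\overline{R}(X,Y)X,Y\rangle$ equals the sectional curvature of the plane spanned by $X,Y$ times $|X\wedge Y|^2=|X|^2|Y|^2-\langle X,Y\rangle^2$. With $\{e_{n+1},\dots,e_m\}$ a local orthonormal frame of normal fields along $\Sigma^n$ and $\overline\nabla$ the Levi-Civita connection of $\overline{M}^m$, the shape operators $A_\alpha$ ($n+1\le\alpha\le m$) are defined by $\langle A_\alpha(X),Y\rangle=\langle\overline\nabla_XY,e_\alpha\rangle$ for tangent $X,Y$. The squared norm of the second fundamental form is $S=\sum_\alpha\operatorname{tr}(A_\alpha^2)$, the mean curvature vector is $h=\frac1n\sum_\alpha\operatorname{tr}(A_\alpha)e_\alpha$, and the mean curvature function is $H=|h|$. *)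

(* Defs.v *)
From HB Require Import structures.
From mathcomp Require Import all_boot all_order all_algebra.
From mathcomp Require Import all_classical all_reals all_analysis.
From mathcomp Require Import ring.
Import Order.TTheory GRing.Theory Num.Theory.
Import numFieldNormedType.Exports.

Set Implicit Arguments.
Unset Strict Implicit.
Unset Printing Implicit Defensive.

Local Open Scope classical_set_scope.
Local Open Scope ring_scope.

(** * Smooth maps between coordinate spaces *)

(* For an open set [D], [Ck k D f] says that [f] has Fréchet derivatives up to
   order [k] on [D] and that they are continuous; directional derivatives along
   all constant vectors stand for the higher-order differentials. *)
Fixpoint Ck (R : realType) (V W : normedModType R) (k : nat)
    (D : set V) (f : V -> W) : Prop :=
  match k with
  | 0 => forall x, D x -> {for x, continuous f}
  | k'.+1 => (forall x, D x -> differentiable f x) /\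
             (forall v : V, Ck k' D ('D_v f))
  end.

Definition smooth_on (R : realType) (V W : normedModType R)
    (D : set V) (f : V -> W) : Prop := forall k, Ck k D f.

(** * Smooth manifolds *)

(* [fwd] and [bwd] are total functions, mutually inverse homeomorphisms between
   [dom] and [img] only; their values elsewhere are irrelevant. *)
Record chart (R : realType) (T : topologicalType) (n : nat) := Chart {
  dom : set T;
  img : set 'rV[R]_n;
  fwd : T -> 'rV[R]_n;
  bwd : 'rV[R]_n -> T;
  dom_open : open dom;
  img_open : open img;
  fwd_img : forall p, dom p -> img (fwd p);
  bwd_dom : forall x, img x -> dom (bwd x);
  fwdK : forall p, dom p -> bwd (fwd p) = p;
  bwdK : forall x, img x -> fwd (bwd x) = x;
  fwd_continuous : {within dom, continuous fwd};
  bwd_continuous : {within img, continuous bwd}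
}.

Definition transition (R : realType) (T : topologicalType) (n : nat)
    (c c' : chart R T n) : 'rV[R]_n -> 'rV[R]_n := fwd c' \o bwd c.

Record manifold (R : realType) (n : nat) := Manifold {
  carrier :> topologicalType;
  carrier_hausdorff : hausdorff_space carrier;
  carrier_second_countable : @second_countable carrier;
  atlas : set (chart R carrier n);
  atlas_cover : forall p : carrier, exists2 c, atlas c & dom c p;
  atlas_smooth : forall c c', atlas c -> atlas c' ->
    smooth_on (fwd c @` (dom c `&` dom c')) (transition c c')
}.

(* Expression of a map in a chart [b] of the source and [c] of the target. *)
Definition in_charts (R : realType) (n m : nat) (N : manifold R n)
    (M : manifold R m) (f : N -> M) (b : chart R N n) (c : chart R M m) :
  'rV[R]_n -> 'rV[R]_m := fwd c \o f \o bwd b.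

Definition smooth_map (R : realType) (n m : nat) (N : manifold R n)
    (M : manifold R m) (f : N -> M) : Prop :=
  continuous f /\
  forall b c, atlas b -> atlas c ->
    smooth_on (fwd b @` (dom b `&` f @^-1` dom c)) (in_charts f b c).

(* Components, in the charts [b] and [c], of the image by the differential of
   [f] at [p] of the tangent vector with components [u]. *)
Definition tangent_map (R : realType) (n m : nat) (N : manifold R n)
    (M : manifold R m) (f : N -> M) (b : chart R N n) (c : chart R M m)
    (p : N) (u : 'rV[R]_n) : 'rV[R]_m :=
  'D_u (in_charts f b c) (fwd b p).

(* A tangent vector is represented by its components in all the charts around
   its base point, related by the differentials of the transition maps.
   [field_along V f Y] says that [Y c p] are the components in the chart [c] of
   [M] of a vector tangent to [M] at [f p], depending smoothly on [p] in [V]. *)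
Definition field_along (R : realType) (n m : nat) (N : manifold R n)
    (M : manifold R m) (V : set N) (f : N -> M)
    (Y : chart R M m -> N -> 'rV[R]_m) : Prop :=
  (forall c c' p, atlas c -> atlas c' -> V p -> dom c (f p) -> dom c' (f p) ->
     Y c' p = 'D_(Y c p) (transition c c') (fwd c (f p))) /\
  (forall b c, atlas b -> atlas c ->
     smooth_on (fwd b @` (dom b `&` V `&` f @^-1` dom c)) (Y c \o bwd b)).

Definition vector_field (R : realType) (n : nat) (N : manifold R n)
    (V : set N) (X : chart R N n -> N -> 'rV[R]_n) : Prop :=
  field_along V (@id N) X.

(** * Riemannian manifolds *)

Definition inner (R : realType) (n : nat) (G : 'M[R]_n) (u v : 'rV[R]_n) : R :=
  (u *m G *m v^T) 0 0.

Record riemannian (R : realType) (n : nat) := Riemannian {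
  rman :> manifold R n;
  metric : chart R rman n -> rman -> 'M[R]_n;
  metric_sym : forall c p, atlas c -> dom c p -> (metric c p)^T = metric c p;
  metric_pos : forall c p (u : 'rV[R]_n), atlas c -> dom c p -> u != 0 ->
    0 < inner (metric c p) u u;
  metric_compat : forall c c' p (u v : 'rV[R]_n),
    atlas c -> atlas c' -> dom c p -> dom c' p ->
    inner (metric c p) u v =
    inner (metric c' p) ('D_u (transition c c') (fwd c p))
                        ('D_v (transition c c') (fwd c p));
  metric_smooth : forall c, atlas c ->
    smooth_on (img c) (metric c \o bwd c)
}.

Definition metric_in (R : realType) (n : nat) (N : riemannian R n)
    (c : chart R N n) : 'rV[R]_n -> 'M[R]_n := metric c \o bwd c.

Definition isometric_immersion (R : realType) (n m : nat)
    (N : riemannian R n) (M : riemannian R m) (f : N -> M) : Prop :=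
  [/\ smooth_map f,
      (forall p b c, atlas b -> atlas c -> dom b p -> dom c (f p) ->
         injective (tangent_map f b c p)) &
      (forall p b c u v, atlas b -> atlas c -> dom b p -> dom c (f p) ->
         inner (metric c (f p)) (tangent_map f b c p u) (tangent_map f b c p v)
         = inner (metric b p) u v)].

(** * Levi-Civita connection and curvature in coordinates *)

(* [christoffel G x u v] is the Levi-Civita derivative at [x] of the constant
   field [v] in the direction [u], given by the Koszul formula for the metric
   [G]; see [levi_civitaP] below. *)
Definition christoffel (R : realType) (n : nat) (G : 'rV[R]_n -> 'M[R]_n)
    (x u v : 'rV[R]_n) : 'rV[R]_n :=
  (\row_l ((inner ('D_u G x) v (delta_mx 0 l)
          + inner ('D_v G x) u (delta_mx 0 l)
          - inner ('D_(delta_mx 0 l) G x) u v) / 2)) *m invmx (G x).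

(* Levi-Civita derivative at [x], in the direction [u], of a field [Y] along a
   map [F] (a field on the target when [F = id]). *)
Definition nabla (R : realType) (n m : nat) (G : 'rV[R]_m -> 'M[R]_m)
    (F : 'rV[R]_n -> 'rV[R]_m) (Y : 'rV[R]_n -> 'rV[R]_m)
    (u x : 'rV[R]_n) : 'rV[R]_m :=
  'D_u Y x + christoffel G (F x) ('D_u F x) (Y x).

Definition bracket (R : realType) (n : nat)
    (U V : 'rV[R]_n -> 'rV[R]_n) (x : 'rV[R]_n) : 'rV[R]_n :=
  'D_(U x) V x - 'D_(V x) U x.

(* The sign makes <R(X,Y)X,Y> the sectional curvature for orthonormal X, Y. *)
Definition curvature_op (R : realType) (n : nat) (G : 'rV[R]_n -> 'M[R]_n)
    (U V W : 'rV[R]_n -> 'rV[R]_n) (x : 'rV[R]_n) : 'rV[R]_n :=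
  nabla G id (fun y => nabla G id W (U y) y) (V x) x
  - nabla G id (fun y => nabla G id W (V y) y) (U x) x
  + nabla G id W (bracket U V x) x.

(* The curvature operator is tensorial: its value on tangent vectors is
   computed on their constant extensions in the chart. *)
Definition curvature (R : realType) (n : nat) (N : riemannian R n)
    (c : chart R N n) (p : N) (u v w : 'rV[R]_n) : 'rV[R]_n :=
  curvature_op (metric_in c) (cst u) (cst v) (cst w) (fwd c p).

(* Ric(u, v) is the trace of z |-> R(u, z) v. *)
Definition ricci (R : realType) (n : nat) (N : riemannian R n)
    (c : chart R N n) (p : N) (u v : 'rV[R]_n) : R :=
  \sum_(i < n) (curvature c p u (delta_mx 0 i) v) 0 i.

(** * Submanifolds *)

Definition tangent_frame (R : realType) (n : nat) (N : riemannian R n)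
    (V : set N) (e : 'I_n -> chart R N n -> N -> 'rV[R]_n) : Prop :=
  (forall i, vector_field V (e i)) /\
  (forall b p i j, atlas b -> V p -> dom b p ->
     inner (metric b p) (e i b p) (e j b p) = (i == j)%:R).

Definition normal_frame (R : realType) (n m : nat) (N : riemannian R n)
    (M : riemannian R m) (f : N -> M) (V : set N)
    (nu : 'I_(m - n) -> chart R M m -> N -> 'rV[R]_m) : Prop :=
  [/\ (forall a, field_along V f (nu a)),
      (forall b c p a u, atlas b -> atlas c -> V p -> dom b p -> dom c (f p) ->
         inner (metric c (f p)) (tangent_map f b c p u) (nu a c p) = 0) &
      (forall c p a a', atlas c -> V p -> dom c (f p) ->
         inner (metric c (f p)) (nu a c p) (nu a' c p) = (a == a')%:R)].

(* The matrix [A], acting on row vectors, of the operator such that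
   <u A, v> = <nabla_u (dF v), xi>; it is determined by the coordinate fields.
   [shape_mxP] below extends this identity to all tangent fields. *)
Definition shape_mx (R : realType) (n m : nat) (g : 'M[R]_n)
    (G : 'rV[R]_m -> 'M[R]_m) (F : 'rV[R]_n -> 'rV[R]_m) (xi : 'rV[R]_m)
    (x : 'rV[R]_n) : 'M[R]_n :=
  (\matrix_(i, j) inner (G (F x))
     (nabla G F ('D_(delta_mx 0 j) F) (delta_mx 0 i) x) xi) *m invmx g.

Section SecondFundamentalForm.
Variables (R : realType) (n m : nat) (N : riemannian R n) (M : riemannian R m).
Variables (f : N -> M) (nu : 'I_(m - n) -> chart R M m -> N -> 'rV[R]_m).
Variables (b : chart R N n) (c : chart R M m) (p : N).

Definition shape_operator (a : 'I_(m - n)) : 'M[R]_n :=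
  shape_mx (metric b p) (metric_in c) (in_charts f b c) (nu a c p) (fwd b p).

Definition sqnorm_sff : R :=
  \sum_a \tr (shape_operator a *m shape_operator a).

Definition mean_curvature_vector : 'rV[R]_m :=
  n%:R^-1 *: \sum_a (\tr (shape_operator a) *: nu a c p).

Definition mean_curvature : R :=
  Num.sqrt (inner (metric c (f p)) mean_curvature_vector mean_curvature_vector).

End SecondFundamentalForm.

(** * Characterizations *)

Lemma innerDl (R : realType) (n : nat) (G : 'M[R]_n) u u' v :
  inner G (u + u') v = inner G u v + inner G u' v.
Proof. by rewrite /inner !mulmxDl mxE. Qed.

Lemma innerZl (R : realType) (n : nat) (G : 'M[R]_n) k u v :
  inner G (k *: u) v = k * inner G u v.
Proof. by rewrite /inner -!scalemxAl mxE. Qed.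

Lemma innerDr (R : realType) (n : nat) (G : 'M[R]_n) u v v' :
  inner G u (v + v') = inner G u v + inner G u v'.
Proof. by rewrite /inner linearD /= mulmxDr mxE. Qed.

Lemma innerZr (R : realType) (n : nat) (G : 'M[R]_n) k u v :
  inner G u (k *: v) = k * inner G u v.
Proof. by rewrite /inner linearZ /= -scalemxAr mxE. Qed.

Lemma inner0l (R : realType) (n : nat) (G : 'M[R]_n) v : inner G 0 v = 0.
Proof. by rewrite /inner !mul0mx mxE. Qed.

Lemma inner_suml (R : realType) (n : nat) (G : 'M[R]_n) (I : finType)
    (u : I -> 'rV[R]_n) v :
  inner G (\sum_i u i) v = \sum_i inner G (u i) v.
Proof. by rewrite /inner !mulmx_suml summxE. Qed.

Lemma inner_sumr (R : realType) (n : nat) (G : 'M[R]_n) (I : finType)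
    (u : I -> 'rV[R]_n) v :
  inner G v (\sum_i u i) = \sum_i inner G v (u i).
Proof. by rewrite /inner linear_sum /= mulmx_sumr summxE. Qed.

Lemma inner_delta (R : realType) (n : nat) (G : 'M[R]_n) u i :
  inner G u (delta_mx 0 i) = (u *m G) 0 i.
Proof. by rewrite /inner trmx_delta -colE mxE. Qed.

Lemma innerC (R : realType) (n : nat) (G : 'M[R]_n) u v :
  G^T = G -> inner G u v = inner G v u.
Proof.
move=> sG; rewrite /inner -[in LHS](trmxK (u *m G *m v^T)) mxE.
by rewrite !trmx_mul trmxK sG mulmxA.
Qed.

Lemma inner_inj (R : realType) (n : nat) (G : 'M[R]_n) u v :
  G \in unitmx -> (forall i, inner G u (delta_mx 0 i) = inner G v (delta_mx 0 i)) ->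
  u = v.
Proof.
move=> uG h; suff e : u *m G = v *m G by rewrite -(mulmxK uG u) e mulmxK.
by apply/rowP => i; rewrite -!inner_delta.
Qed.

Lemma posdef_unitmx (R : realType) (n : nat) (G : 'M[R]_n) :
  (forall u, u != 0 -> 0 < inner G u u) -> G \in unitmx.
Proof.
move=> pG; rewrite -row_free_unit -kermx_eq0; apply/eqP/row_matrixP => i.
rewrite row0; apply/eqP/negPn/negP => /pG.
have /sub_kermxP h : (row i (kermx G) <= kermx G)%MS by rewrite row_sub.
by rewrite /inner h mul0mx mxE ltxx.
Qed.

Lemma derive_lin (R : realType) (V W : normedModType R) (f : V -> W) (x : V)
    (k : nat) (a : 'I_k -> R) (v : 'I_k -> V) :
  differentiable f x ->
  'D_(\sum_j a j *: v j) f x = \sum_j a j *: 'D_(v j) f x.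
Proof.
move=> df; rewrite deriveE // linear_sum; apply: eq_bigr => j _.
by rewrite linearZ /= deriveE.
Qed.

Lemma row_delta (R : realType) (n : nat) (u : 'rV[R]_n) :
  \sum_j u 0 j *: delta_mx 0 j = u.
Proof. by rewrite [RHS]row_sum_delta. Qed.

Lemma inner_sum_delta (R : realType) (n : nat) (A : 'M[R]_n) (z w : 'rV[R]_n) :
  inner A z w = \sum_l w 0 l * inner A z (delta_mx 0 l).
Proof.
rewrite -[in LHS](row_delta w) inner_sumr; apply: eq_bigr => l _.
exact: innerZr.
Qed.

Lemma koszulP (R : realType) (V : Type) (I : V -> V -> R)
    (B : V -> V -> V -> R) (C Gamma : V -> V -> V) :
  (forall u v, I u v = I v u) -> (forall u v, (forall w, I u w = I v w) -> u = v) ->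
  (forall w u v, B w u v = B w v u) ->
  (forall u v w, I (C u v) w = (B u v w + B v u w - B w u v) / 2) ->
  (forall u v, Gamma u v = Gamma v u) /\
  (forall u v w, B w u v = I (Gamma w u) v + I u (Gamma w v)) <-> Gamma = C.
Proof.
move=> sI injI sB K; split=> [[tf mc]|->].
  apply/funext => u; apply/funext => v; apply: injI => w.
  rewrite K (mc v w u) (mc u w v) (mc u v w) (tf v u) (tf w u) (tf w v).
  by rewrite (sI v (Gamma u w)); field.
split=> [u v|u v w]; first by apply: injI => w; rewrite !K (sB w v u) (addrC (B v u w)).
by rewrite (sI u (C w v)) !K (sB w v u); field.
Qed.

Section LeviCivita.
Variables (R : realType) (n : nat) (G : 'rV[R]_n -> 'M[R]_n) (x : 'rV[R]_n).
Hypothesis G_diff : differentiable G x.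
Hypothesis G_sym : \forall y \near x, (G y)^T = G y.
Hypothesis G_pos : forall u, u != 0 -> 0 < inner (G x) u u.

Lemma derive_metric_sym u : ('D_u G x)^T = 'D_u G x.
Proof.
have dG : derivable G x u by apply: diff_derivable.
apply/matrixP => i j; rewrite mxE derive_mx // !mxE; apply: near_eq_derive.
by near=> y; rewrite -[in LHS](near G_sym y) ?mxE.
Unshelve. all: by end_near. Qed.

Lemma christoffel_delta u v l :
  inner (G x) (christoffel G x u v) (delta_mx 0 l) =
  (inner ('D_u G x) v (delta_mx 0 l) + inner ('D_v G x) u (delta_mx 0 l)
   - inner ('D_(delta_mx 0 l) G x) u v) / 2.
Proof.
rewrite inner_delta /christoffel (mulmxKV (posdef_unitmx G_pos)).
by rewrite [LHS]mxE.
Qed.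

Lemma inner_derive_delta u v w :
  inner ('D_w G x) u v = \sum_l w 0 l * inner ('D_(delta_mx 0 l) G x) u v.
Proof.
rewrite -[in LHS](row_delta w).
rewrite (@derive_lin _ _ _ G x _ (w 0) (fun l => delta_mx 0 l) G_diff).
rewrite /inner mulmx_sumr mulmx_suml summxE; apply: eq_bigr => j _.
by rewrite -scalemxAr -scalemxAl [LHS]mxE.
Qed.

Lemma koszul u v w :
  inner (G x) (christoffel G x u v) w =
  (inner ('D_u G x) v w + inner ('D_v G x) u w - inner ('D_w G x) u v) / 2.
Proof.
transitivity ((\sum_l w 0 l * inner ('D_u G x) v (delta_mx 0 l)
  + \sum_l w 0 l * inner ('D_v G x) u (delta_mx 0 l)
  - \sum_l w 0 l * inner ('D_(delta_mx 0 l) G x) u v) / 2); last first.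
  congr ((_ + _ - _) / 2); apply/esym.
  - exact: inner_sum_delta.
  - exact: inner_sum_delta.
  - exact: inner_derive_delta.
apply: (etrans (inner_sum_delta _ _ _)).
rewrite -big_split -sumrB mulr_suml; apply: eq_bigr => l _.
apply: (etrans (congr1 ( *%R (w 0 l)) (christoffel_delta u v l))).
by apply: (etrans (mulrA _ _ _)); congr (_ / 2); rewrite mulrBr mulrDr.
Qed.

Definition torsion_free_metric (Gamma : 'rV[R]_n -> 'rV[R]_n -> 'rV[R]_n) :=
  (forall u v, Gamma u v = Gamma v u) /\
  (forall u v w, inner ('D_w G x) u v =
                 inner (G x) (Gamma w u) v + inner (G x) u (Gamma w v)).

Lemma levi_civitaP (Gamma : 'rV[R]_n -> 'rV[R]_n -> 'rV[R]_n) :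
  torsion_free_metric Gamma <-> Gamma = christoffel G x.
Proof.
have sG : (G x)^T = G x := nbhs_singleton G_sym.
have uG : G x \in unitmx by apply: posdef_unitmx.
have sD w u v : inner ('D_w G x) u v = inner ('D_w G x) v u.
  by apply/innerC/derive_metric_sym.
apply: (@koszulP _ _ (inner (G x)) (fun w => inner ('D_w G x))) => //.
- by move=> u v; apply: innerC.
- by move=> u v e; apply: (inner_inj uG) => i; apply: e.
- exact: koszul.
Qed.

End LeviCivita.

Lemma koszul_lin (R : realType) (n k : nat) (B : 'rV[R]_n -> 'M[R]_n)
    (a : 'I_k -> R) (v : 'I_k -> 'rV[R]_n) (u d : 'rV[R]_n) :
  B (\sum_j a j *: v j) = \sum_j a j *: B (v j) ->
  (inner (B u) (\sum_j a j *: v j) d + inner (B (\sum_j a j *: v j)) u d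
   - inner (B d) u (\sum_j a j *: v j)) / 2 =
  \sum_j a j * ((inner (B u) (v j) d + inner (B (v j)) u d
                 - inner (B d) u (v j)) / 2) /\
  (inner (B (\sum_j a j *: v j)) u d + inner (B u) (\sum_j a j *: v j) d
   - inner (B d) (\sum_j a j *: v j) u) / 2 =
  \sum_j a j * ((inner (B (v j)) u d + inner (B u) (v j) d
                 - inner (B d) (v j) u) / 2).
Proof.
move=> ->; have -> : inner (\sum_j a j *: B (v j)) u d =
    \sum_j a j * inner (B (v j)) u d.
  rewrite /inner mulmx_sumr mulmx_suml summxE; apply: eq_bigr => j _.
  by rewrite -scalemxAr -scalemxAl [LHS]mxE.
rewrite !inner_suml inner_sumr -!big_split -!sumrB !mulr_suml.
by split; apply: eq_bigr => j _; rewrite !(innerZl, innerZr) mulrA mulrBr mulrDr.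
Qed.

Lemma christoffel_sumr (R : realType) (n : nat) (G : 'rV[R]_n -> 'M[R]_n)
    (x u : 'rV[R]_n) (k : nat) (a : 'I_k -> R) (v : 'I_k -> 'rV[R]_n) :
  differentiable G x ->
  christoffel G x u (\sum_j a j *: v j) = \sum_j a j *: christoffel G x u (v j).
Proof.
move=> dG; rewrite /christoffel.
under [RHS]eq_bigr do rewrite scalemxAl.
rewrite -mulmx_suml; congr (_ *m _); apply/rowP => l.
rewrite summxE [LHS]mxE.
apply: (etrans (koszul_lin _ _ (derive_lin a v dG)).1).
by apply: eq_bigr => j _; rewrite [RHS]mxE [X in _ = _ * X]mxE.
Qed.

Lemma christoffel_suml (R : realType) (n : nat) (G : 'rV[R]_n -> 'M[R]_n)
    (x u : 'rV[R]_n) (k : nat) (a : 'I_k -> R) (v : 'I_k -> 'rV[R]_n) :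
  differentiable G x ->
  christoffel G x (\sum_j a j *: v j) u = \sum_j a j *: christoffel G x (v j) u.
Proof.
move=> dG; rewrite /christoffel.
under [RHS]eq_bigr do rewrite scalemxAl.
rewrite -mulmx_suml; congr (_ *m _); apply/rowP => l.
rewrite summxE [LHS]mxE.
apply: (etrans (koszul_lin _ _ (derive_lin a v dG)).2).
by apply: eq_bigr => j _; rewrite [RHS]mxE [X in _ = _ * X]mxE.
Qed.

Lemma derive_entry (R : realType) (n m : nat) (x u : 'rV[R]_n)
    (P : 'rV[R]_n -> 'rV[R]_m) l :
  derivable P x u -> ('D_u P x) 0 l = 'D_u (fun y => P y 0 l) x.
Proof. by move=> dP; rewrite derive_mx // [LHS]mxE. Qed.

Lemma is_derive_scale (R : realType) (n m : nat) (x u : 'rV[R]_n)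
    (a : 'rV[R]_n -> R) (P : 'rV[R]_n -> 'rV[R]_m) :
  derivable a x u -> derivable P x u ->
  is_derive x u (fun y => a y *: P y) ('D_u a x *: P x + a x *: 'D_u P x).
Proof.
move=> da dP.
have dPc l : derivable (fun y => P y 0 l) x u.
  by have /derivable_mxP := dP; apply.
have entryE l : (fun y => (a y *: P y) 0 l) = a * (fun y => P y 0 l).
  by apply/funext => y; rewrite [LHS]mxE.
have d : derivable (fun y => a y *: P y) x u.
  apply/derivable_mxP => i l; rewrite (ord1 i) entryE.
  exact: (derivableM da (dPc l)).
split=> //; apply/rowP => l.
apply: (etrans (derive_entry l d)); rewrite entryE.
apply: (etrans (deriveM da (dPc l))); rewrite addrC [RHS]mxE.
congr (_ + _); rewrite [RHS]mxE; first exact: mulrC.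
by congr (_ * _); apply/esym/derive_entry.
Qed.

Lemma derive_sum_scale (R : realType) (n m k : nat) (x u : 'rV[R]_n)
    (a : 'I_k -> 'rV[R]_n -> R) (P : 'I_k -> 'rV[R]_n -> 'rV[R]_m) :
  (forall j, derivable (a j) x u) -> (forall j, derivable (P j) x u) ->
  'D_u (fun y => \sum_j a j y *: P j y) x =
  \sum_j ('D_u (a j) x *: P j x + a j x *: 'D_u (P j) x).
Proof.
move=> da dP.
have -> : (fun y => \sum_j a j y *: P j y) = \sum_j (fun y => a j y *: P j y).
  by apply/funext => y; rewrite fct_sumE.
have daP j := is_derive_scale (da j) (dP j).
rewrite derive_sum => [|j]; last by have [] := daP j.
by apply: eq_bigr => j _; have [] := daP j.
Qed.

Lemma shape_mxP (R : realType) (n m : nat) (g : 'M[R]_n)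
    (G : 'rV[R]_m -> 'M[R]_m) (F : 'rV[R]_n -> 'rV[R]_m) (xi : 'rV[R]_m)
    (x u : 'rV[R]_n) (Y : 'rV[R]_n -> 'rV[R]_n) :
  g \in unitmx -> differentiable G (F x) ->
  (\forall y \near x, differentiable F y) ->
  (forall w, differentiable ('D_w F) x) -> differentiable Y x ->
  (forall w, inner (G (F x)) ('D_w F x) xi = 0) ->
  inner g (u *m shape_mx g G F xi x) (Y x) =
  inner (G (F x)) (nabla G F (fun y => 'D_(Y y) F y) u x) xi.
Proof.
move=> ug dG dF dDF dY nxi.
pose P j : 'rV[R]_n -> 'rV[R]_m := 'D_(delta_mx 0 j) F.
have dFx : differentiable F x := nbhs_singleton dF.
have nabla_lin j : nabla G F (P j) u x =
    \sum_i u 0 i *: nabla G F (P j) (delta_mx 0 i) x.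
  rewrite /nabla; under [RHS]eq_bigr do rewrite scalerDr.
  rewrite big_split; congr (_ + _).
    rewrite -[in LHS](row_delta u).
    exact: (derive_lin (u 0) (fun i => delta_mx 0 i) (dDF _)).
  rewrite -[in LHS](row_delta u).
  rewrite (derive_lin (u 0) (fun i => delta_mx 0 i) dFx).
  exact: (christoffel_suml _ (u 0) (fun i => 'D_(delta_mx 0 i) F x) dG).
have YP y : differentiable F y -> 'D_(Y y) F y = \sum_j Y y 0 j *: P j y.
  move=> dFy; rewrite -[in LHS](row_delta (Y y)).
  exact: (derive_lin (Y y 0) (fun i => delta_mx 0 i) dFy).
have nablaY : nabla G F (fun y => 'D_(Y y) F y) u x =
    \sum_j ('D_u (fun y => Y y 0 j) x *: P j x + Y x 0 j *: nabla G F (P j) u x).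
  rewrite /nabla (YP x dFx).
  rewrite (christoffel_sumr _ (Y x 0) (fun j => P j x) dG).
  have -> : 'D_u (fun y => 'D_(Y y) F y) x =
      'D_u (fun y => \sum_j Y y 0 j *: P j y) x.
    by apply: near_eq_derive; near=> y; apply: YP; near: y.
  rewrite derive_sum_scale => [|j|j]; last 2 first.
  - by have /derivable_mxP := diff_derivable (v := u) dY; apply.
  - exact/diff_derivable/dDF.
  rewrite -big_split; apply: eq_bigr => j _.
  by apply/esym; rewrite [X in _ + X]scalerDr addrA.
have nP j : inner (G (F x)) (P j x) xi = 0 by exact: nxi.
rewrite nablaY inner_suml.
rewrite /shape_mx [in LHS]/inner mulmxA (mulmxKV ug) [LHS]mxE.
apply: eq_bigr => j _; rewrite [X in _ * X]mxE mulrC.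
apply/esym; apply: (etrans (innerDl _ _ _ _)).
have -> : inner (G (F x)) ('D_u (fun y => Y y 0 j) x *: P j x) xi = 0.
  by apply: (etrans (innerZl _ _ _ _)); rewrite nP mulr0.
rewrite add0r; apply: (etrans (innerZl _ _ _ _)); congr (_ * _).
apply: (etrans (congr1 (fun z => inner (G (F x)) z xi) (nabla_lin j))).
apply: (etrans (inner_suml _ _ _)); rewrite [RHS]mxE; apply: eq_bigr => i _.
apply: (etrans (innerZl _ _ _ _)); congr (_ * _).
by rewrite [RHS]mxE.
Unshelve. all: by end_near. Qed.

(* Main.v *)
(* The Gauss equation gives
     Ric(X, X) = sum_i <Rbar(X, e_i)X, e_i>
                 + sum_a (tr A_a <A_a X, X> - |A_a X|^2),
   so only the last sum has to be bounded below. For a unit vector X put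
   h_a = tr A_a / n and phi_a = A_a - h_a; then
     tr A_a <A_a X, X> - |A_a X|^2
       = (n-1) h_a^2 + (n-2) h_a <phi_a X, X> - |phi_a X|^2,
   and one concludes with |phi_a X|^2 <= (n-1)/n tr phi_a^2, valid because
   phi_a is symmetric and traceless, with <phi_a X, X>^2 <= |phi_a X|^2, and
   with the Cauchy-Schwarz inequality for the sum of the h_a <phi_a X, X>. *)
Require Import Defs.
From HB Require Import structures.
From mathcomp Require Import all_boot all_order all_algebra.
From mathcomp Require Import all_classical all_reals all_analysis.
From mathcomp Require Import ring lra.
Import Order.TTheory GRing.Theory Num.Theory.
Import numFieldNormedType.Exports.
Set Implicit Arguments.
Unset Strict Implicit.
Unset Printing Implicit Defensive.
Local Open Scope classical_set_scope.
Local Open Scope ring_scope.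

(** * Calculus *)

(** Curvature is defined on constant extensions in a chart, so the Gauss equation is proved for the
    second derivative [nabla G F ('D_v F) u]: its tangential part is the Christoffel symbol of [g],
    its normal part the second fundamental form. Constant extensions are not parallel, so
    differentiating leaves products of Christoffel symbols; they cancel once the ambient inner
    product is split along the tangent and normal frames. A shape operator is self-adjoint for [g],
    but its matrix in the chart need not be symmetric, so the algebra takes place in the frame [e],
    where [g] becomes the Euclidean product. The constant: the traces of the [phi_a^2] add up to
    [S - n H^2], so Cauchy-Schwarz bounds the sum of the [h_a <phi_a X, X>] by
    [H sqrt((n-1)/n) sqrt(S - n H^2)]. This sum carries the coefficient [n-2], and taking out the
    common factor [(n-1)/n] leaves [n(n-2)/sqrt(n(n-1))]. *)

Lemma is_derive_line (R : realType) (V W : normedModType R) (f : V -> W)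
    (x u : V) (s : R) :
  derivable f (x + s *: u) u ->
  is_derive s 1 (fun t : R => f (x + t *: u)) ('D_u f (x + s *: u)).
Proof.
have e : (fun h : R => h^-1 *: (((fun t : R => f (x + t *: u)) \o shift s) (h *: 1)
             - f (x + s *: u))) =
         (fun h : R => h^-1 *: ((f \o shift (x + s *: u)) (h *: u)
             - f (x + s *: u))).
  apply/funext => h /=; congr (_ *: (f _ - _)).
  by rewrite scalerDl [h *: 1]mulr1 addrCA.
by move=> df; split; rewrite /derivable /derive /= e.
Qed.

(** The mean value theorem is applied twice: to the increment of [f] in the direction [v], as a
    function of [s], and then to ['D_u f] along [v] at the intermediate [s]. *)
Lemma mixed_difference (R : realType) (V : normedModType R) (f : V -> R)
    (x u v : V) (h : R) :
  0 < h ->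
  (forall s t, 0 <= s <= h -> 0 <= t <= h ->
     differentiable f (x + s *: u + t *: v)) ->
  (forall s t, 0 <= s <= h -> 0 <= t <= h ->
     differentiable ('D_u f) (x + s *: u + t *: v)) ->
  exists s t, [/\ 0 <= s <= h, 0 <= t <= h &
    f (x + h *: u + h *: v) - f (x + h *: u) - (f (x + h *: v) - f x) =
    'D_v ('D_u f) (x + s *: u + t *: v) * h ^+ 2].
Proof.
move=> h0 df dDf.
have h00 : 0 <= (0 : R) <= h by apply/andP; split=> //; apply: ltW.
have hhh : 0 <= h <= h by apply/andP; split=> //; apply: ltW.
pose phi s := f ((x + h *: v) + s *: u) - f (x + s *: u).
have dphi s : 0 <= s <= h ->
    is_derive s 1 phi ('D_u f ((x + h *: v) + s *: u) - 'D_u f (x + s *: u)).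
  move=> hs; apply: is_deriveB.
    by apply: is_derive_line; apply/diff_derivable; rewrite addrAC; apply: df.
  apply: is_derive_line; apply/diff_derivable.
  by rewrite -[x + _]addr0 -(scale0r v); apply: df.
have oc (a : R) : a \in `]0, h[%R -> 0 <= a <= h.
  by rewrite in_itv /= => /andP[/ltW -> /ltW ->].
have cphi : {within `[0, h], continuous phi}.
  apply: derivable_within_continuous => s.
  by rewrite in_itv /= => /dphi [].
have [s /oc hs es] := MVT h0 (fun s hs => dphi s (oc s hs)) cphi.
pose psi t := 'D_u f ((x + s *: u) + t *: v).
have dpsi t : 0 <= t <= h ->
    is_derive t 1 psi ('D_v ('D_u f) ((x + s *: u) + t *: v)).
  by move=> ht; apply: is_derive_line; apply/diff_derivable/dDf.
have cpsi : {within `[0, h], continuous psi}.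
  apply: derivable_within_continuous => t.
  by rewrite in_itv /= => /dpsi [].
have [t /oc ht et] := MVT h0 (fun s hs => dpsi s (oc s hs)) cpsi.
exists s, t; split=> //.
move: es et; rewrite /phi /psi !subr0 !scale0r !addr0 => es et.
rewrite expr2 mulrA -et (addrAC x (s *: u)) -es (addrAC x (h *: u)).
done.
Qed.

(** The second difference is symmetric in [u] and [v], so the two mixed derivatives take a common
    value, each at some point of the same small parallelogram; continuity at [x] carries this to the
    limit. *)
Lemma mixed_derive_comm (R : realType) (V : normedModType R) (f : V -> R)
    (x u v : V) (D : set V) :
  open D -> D x ->
  (forall y, D y -> differentiable f y) ->
  (forall w y, D y -> differentiable ('D_w f) y) ->
  {for x, continuous ('D_v ('D_u f))} ->
  {for x, continuous ('D_u ('D_v f))} ->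
  'D_v ('D_u f) x = 'D_u ('D_v f) x.
Proof.
move=> oD Dx df dDf cuv cvu.
apply/eqP; rewrite -subr_eq0 -normr_le0; apply/ler_addgt0Pl => eps eps0.
rewrite addr0.
have e20 : 0 < eps / 2 by rewrite divr_gt0.
have nD : \forall y \near x, D y by apply: open_nbhs_nbhs.
have n1 : \forall y \near x, `|'D_v ('D_u f) x - 'D_v ('D_u f) y| < eps / 2.
  by move/cvgrPdist_lt : cuv; apply.
have n2 : \forall y \near x, `|'D_u ('D_v f) x - 'D_u ('D_v f) y| < eps / 2.
  by move/cvgrPdist_lt : cvu; apply.
have [r /= r0 hr] := (nbhs_ballP _ _).1 (filterI nD (filterI n1 n2)).
(* With this [h] the whole parallelogram lies within [r / 2] of [x]; the summand 1 keeps the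
   denominator positive when [u] and [v] vanish. *)
pose h := r / (2 * (1 + `|u| + `|v|)).
have uv0 : 0 < 1 + `|u| + `|v|.
  by rewrite ltr_pwDl // ltr_pwDl.
have h0 : 0 < h by rewrite divr_gt0 // mulr_gt0.
have near_x s t : 0 <= s <= h -> 0 <= t <= h -> ball x r (x + s *: u + t *: v).
  move=> /andP[s0 sh] /andP[t0 th]; rewrite -ball_normE /ball_ /=.
  rewrite -addrA opprD addNKr normrN.
  apply: (le_lt_trans (ler_normD _ _)); rewrite !normrZ !ger0_norm //.
  apply: (@le_lt_trans _ _ (h * (1 + `|u| + `|v|))).
    rewrite -addrA mulrDr mulr1 mulrDr -[leLHS]add0r lerD ?(ltW h0) //.
    by rewrite lerD // ler_wpM2r.
  rewrite (_ : _ * _ = r / 2); last by rewrite /h; field; rewrite gt_eqF.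
  by rewrite ltr_pdivrMr // mulr_natr mulr2n ltrDl.
have [s [t [hs ht e1]]] := @mixed_difference R V f x u v h h0
  (fun s t hs ht => df _ (hr _ (near_x s t hs ht)).1)
  (fun s t hs ht => dDf _ _ (hr _ (near_x s t hs ht)).1).
have near_x' s' t' : 0 <= s' <= h -> 0 <= t' <= h -> ball x r (x + s' *: v + t' *: u).
  by move=> hs' ht'; rewrite addrAC; apply: near_x.
have [t' [s' [ht' hs' e2]]] := @mixed_difference R V f x v u h h0
  (fun s t hs ht => df _ (hr _ (near_x' s t hs ht)).1)
  (fun s t hs ht => dDf _ _ (hr _ (near_x' s t hs ht)).1).
have e3 : 'D_v ('D_u f) (x + s *: u + t *: v) = 'D_u ('D_v f) (x + t' *: v + s' *: u).
  apply: (@mulIf _ (h ^+ 2)); first by rewrite expf_neq0 // gt_eqF.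
  by rewrite -e1 -e2 (addrAC x (h *: v)); ring.
have [_ [b1 _]] := hr _ (near_x s t hs ht).
have [_ [_ b2]] := hr _ (near_x' t' s' ht' hs').
have dist_half (a b c e : R) : `|a - c| < e / 2 -> `|b - c| < e / 2 -> `|a - b| <= e.
  move=> ac bc; have -> : a - b = (a - c) - (b - c) by ring.
  have := ltrD ac bc; rewrite -splitr => /ltW.
  by apply: le_trans; apply: ler_normB.
by move: b1; rewrite e3 => b1; exact: dist_half b1 b2.
Qed.

(** * Differential calculus of matrix-valued maps *)

Lemma near_eq_differentiable (R : realType) (V W : normedModType R)
    (f g : V -> W) (x : V) :
  (\forall y \near x, f y = g y) -> differentiable f x -> differentiable g x.
Proof.
move=> fg /diff_locallyP[cf /eqaddoP ef].
have e : g \o shift x = cst (g x) + 'd f x +o_ 0 id.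
  apply/eqaddoP => eps eps0; rewrite -(nbhs_singleton fg).
  have fg0 : \forall h \near (0 : V), f (h + x) = g (h + x).
    by move: fg; rewrite (near_shift 0) subr0.
  near=> h; rewrite /= -[X in `|X|]/(g (h + x) - (f x + 'd f x h)).
  have <- : f (h + x) = g (h + x) by near: h.
  by near: h; apply: ef.
by apply/diff_locallyP; rewrite (diff_unique cf e).
Unshelve. all: by end_near. Qed.

Lemma differentiable_mxP (R : realType) (V : normedModType R) (p q : nat)
    (A : V -> 'M[R]_(p, q)) (x : V) :
  differentiable A x <-> forall i j, differentiable (fun y => A y i j) x.
Proof.
split=> [dA i j|dA].
  have := differentiable_comp dA (differentiable_coord (A x) i j).
  exact.
have -> : A = \sum_(i < p) \sum_(j < q) (fun y => A y i j *: delta_mx i j).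
  apply/funext => y; rewrite [LHS]matrix_sum_delta fct_sumE.
  by apply: eq_bigr => i _; rewrite fct_sumE.
apply: differentiable_sum => i; apply: differentiable_sum => j.
exact: differentiableZl.
Qed.

Lemma differentiable_bigsum (R : realType) (V W : normedModType R) (I : Type)
    (r : seq I) (P : pred I) (f : I -> V -> W) (x : V) :
  (forall i, P i -> differentiable (f i) x) ->
  differentiable (fun y => \sum_(i <- r | P i) f i y) x.
Proof.
move=> df; rewrite (_ : (fun y => _) = \sum_(i <- r | P i) f i); last first.
  by apply/funext => y; rewrite fct_sumE.
elim/big_ind : _ => // g h; exact: differentiableD.
Qed.

Lemma differentiable_bigprod (R : realType) (V : normedModType R) (I : Type)
    (r : seq I) (P : pred I) (f : I -> V -> R) (x : V) :
  (forall i, P i -> differentiable (f i) x) ->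
  differentiable (fun y => \prod_(i <- r | P i) f i y) x.
Proof.
move=> df; rewrite (_ : (fun y => _) = \prod_(i <- r | P i) f i); last first.
  by apply/funext => y; rewrite fct_prodE.
elim/big_ind : _ => // g h; exact: differentiableM.
Qed.

Lemma differentiable_mulmx (R : realType) (V : normedModType R) (p q r : nat)
    (A : V -> 'M[R]_(p, q)) (B : V -> 'M[R]_(q, r)) (x : V) :
  differentiable A x -> differentiable B x ->
  differentiable (fun y => A y *m B y) x.
Proof.
move=> /differentiable_mxP dA /differentiable_mxP dB.
apply/differentiable_mxP => i j.
under eq_fun do rewrite mxE.
apply: differentiable_bigsum => k _.
exact: (differentiableM (dA i k) (dB k j)).
Qed.

Lemma differentiable_trmx (R : realType) (V : normedModType R) (p q : nat)
    (A : V -> 'M[R]_(p, q)) (x : V) :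
  differentiable A x -> differentiable (fun y => (A y)^T) x.
Proof.
move=> /differentiable_mxP dA; apply/differentiable_mxP => i j.
by under eq_fun do rewrite mxE.
Qed.

Lemma differentiable_det (R : realType) (V : normedModType R) (q : nat)
    (A : V -> 'M[R]_q) (x : V) :
  (forall i j, differentiable (fun y => A y i j) x) ->
  differentiable (fun y => \det (A y)) x.
Proof.
move=> dA; rewrite /determinant; apply: differentiable_bigsum => s _.
apply: (differentiableM (differentiable_cst _ x)).
exact: differentiable_bigprod.
Qed.

(** By Cramer's rule the inverse is the adjugate over the determinant, both polynomial in the
    entries. Invertibility is asked near [x] because [invmx] agrees with this quotient only on
    units. *)
Lemma differentiable_invmx (R : realType) (V : normedModType R) (q : nat)
    (A : V -> 'M[R]_q) (x : V) :
  (\forall y \near x, A y \in unitmx) -> differentiable A x ->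
  differentiable (fun y => invmx (A y)) x.
Proof.
move=> uA /differentiable_mxP dA.
have d i j : differentiable (fun y => (\det (A y))^-1 * (\adj (A y)) i j) x.
  have dV : differentiable (fun y => (\det (A y))^-1) x.
    apply: differentiableV; first exact: differentiable_det.
    by have := nbhs_singleton uA; rewrite unitmxE unitfE.
  apply: (differentiableM dV); under eq_fun do rewrite mxE /cofactor.
  apply: (differentiableM (differentiable_cst _ x)).
  apply: differentiable_det => k l.
  by under eq_fun do rewrite !mxE.
pose B (y : V) : 'M[R]_q := \matrix_(i, j) ((\det (A y))^-1 * (\adj (A y)) i j).
have dB : differentiable B x.
  apply/differentiable_mxP => i j; rewrite /B.
  by under eq_fun do rewrite mxE.
have nAB : \forall y \near x, B y = invmx (A y).
  near=> y.
  have uAy : A y \in unitmx by near: y.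
  by apply/matrixP => i j; rewrite /invmx uAy [LHS]mxE [RHS]mxE.
exact: near_eq_differentiable nAB dB.
Unshelve. all: by end_near. Qed.

Lemma is_derive_mulmx (R : realType) (V : normedModType R) (p q r : nat)
    (A : V -> 'M[R]_(p, q)) (B : V -> 'M[R]_(q, r)) (x u : V) :
  differentiable A x -> differentiable B x ->
  is_derive x u (fun y => A y *m B y) ('D_u A x *m B x + A x *m 'D_u B x).
Proof.
move=> dA dB.
have dAB : derivable (fun y => A y *m B y) x u.
  exact/diff_derivable/differentiable_mulmx.
have dAx : derivable A x u by apply: diff_derivable.
have dBx : derivable B x u by apply: diff_derivable.
split=> //; apply/matrixP => i j; rewrite derive_mx // [LHS]mxE.
have e : (fun y => (A y *m B y) i j) =
    \sum_k ((fun y => A y i k) * (fun y => B y k j)).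
  by apply/funext => y; rewrite [LHS]mxE fct_sumE.
have dAe k : derivable (fun y => A y i k) x u.
  by have /derivable_mxP := dAx; apply.
have dBe k : derivable (fun y => B y k j) x u.
  by have /derivable_mxP := dBx; apply.
rewrite e derive_sum => [|k]; last exact: derivableM.
rewrite [RHS]mxE; transitivity (\sum_k ('D_u A x i k * B x k j + A x i k * 'D_u B x k j)).
  apply: eq_bigr => k _; apply: (etrans (deriveM (dAe k) (dBe k))).
  rewrite (derive_mx dAx) (derive_mx dBx) !mxE addrC; congr (_ + _); exact: mulrC.
by rewrite big_split /=; congr (_ + _); rewrite [RHS]mxE.
Qed.

Lemma is_derive_trmx (R : realType) (V : normedModType R) (p q : nat)
    (A : V -> 'M[R]_(p, q)) (x u : V) :
  differentiable A x -> is_derive x u (fun y => (A y)^T) ('D_u A x)^T.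
Proof.
move=> dA; have dAx : derivable A x u by apply: diff_derivable.
have dAt : derivable (fun y => (A y)^T) x u.
  exact/diff_derivable/differentiable_trmx.
split=> //; apply/matrixP => i j; rewrite (derive_mx dAt) (derive_mx dAx) !mxE.
by congr ('D_u _ x); apply/funext => y; rewrite mxE.
Qed.

Lemma is_derive_inner (R : realType) (V : normedModType R) (n : nat)
    (H : V -> 'M[R]_n) (P Q : V -> 'rV[R]_n) (x u : V) :
  differentiable H x -> differentiable P x -> differentiable Q x ->
  is_derive x u (fun y => inner (H y) (P y) (Q y))
    (inner ('D_u H x) (P x) (Q x) + inner (H x) ('D_u P x) (Q x)
     + inner (H x) (P x) ('D_u Q x)).
Proof.
move=> dH dP dQ.
have dPH := differentiable_mulmx dP dH.
have dQt := differentiable_trmx dQ.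
have dall := differentiable_mulmx dPH dQt.
split.
  by apply: diff_derivable; apply: (differentiable_mxP _ _).1 dall _ _.
have [d e] := is_derive_mulmx u dPH dQt.
transitivity (('D_u (fun y => P y *m H y *m (Q y)^T) x) 0 0).
  by rewrite derive_mx // mxE.
rewrite e.
have [_ ->] := is_derive_mulmx u dP dH.
have [_ ->] := is_derive_trmx u dQ.
rewrite /inner mulmxDl [LHS]mxE [in LHS]mxE; congr (_ + _); exact: addrC.
Qed.

Lemma derive_comp (R : realType) (U V W : normedModType R) (F : U -> V)
    (G : V -> W) (x u : U) :
  differentiable F x -> differentiable G (F x) ->
  'D_u (G \o F) x = 'D_('D_u F x) G (F x).
Proof.
move=> dF dG; have dGF := differentiable_comp dF dG.
by rewrite !deriveE // diff_comp.
Qed.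

(** * Smooth maps and symmetry of their second derivatives *)

Lemma smooth_on_differentiable (R : realType) (V W : normedModType R)
    (D : set V) (f : V -> W) (x : V) :
  smooth_on D f -> D x -> differentiable f x.
Proof. by move=> sf Dx; have [+ _] := sf 1%N; apply. Qed.

Lemma smooth_on_derive (R : realType) (V W : normedModType R)
    (D : set V) (f : V -> W) (v : V) :
  smooth_on D f -> smooth_on D ('D_v f).
Proof. by move=> sf k; have [_] := sf k.+1; apply. Qed.

(** The mean value argument is scalar, so the claim is reduced to the entries of [F]; most of the
    work is to exchange taking an entry with iterated directional derivatives on [D]. *)
Lemma smooth_derive_comm (R : realType) (n m : nat) (D : set 'rV[R]_n)
    (F : 'rV[R]_n -> 'rV[R]_m) (x u v : 'rV[R]_n) :
  open D -> smooth_on D F -> D x ->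
  'D_u ('D_v F) x = 'D_v ('D_u F) x.
Proof.
move=> oD sF Dx.
have diffE H y : smooth_on D H -> D y -> differentiable (H : _ -> 'rV[R]_m) y.
  exact: smooth_on_differentiable.
have near_D y : D y -> \forall z \near y, D z.
  by move=> Dy; apply: open_nbhs_nbhs.
have entry1 (H : 'rV[R]_n -> 'rV[R]_m) l w y : smooth_on D H -> D y ->
    ('D_w H y) 0 l = 'D_w (fun z => H z 0 l) y.
  by move=> sH Dy; apply/derive_entry/diff_derivable/diffE.
have entry2 l w w' y : D y ->
    ('D_w ('D_w' F) y) 0 l = 'D_w ('D_w' (fun z => F z 0 l)) y.
  move=> Dy; rewrite entry1 //; last exact: smooth_on_derive.
  apply: near_eq_derive; apply: filterS (near_D y Dy) => z Dz.
  exact: entry1.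
have entry_diff (H : 'rV[R]_n -> 'rV[R]_m) l y : smooth_on D H -> D y ->
    differentiable (fun z => H z 0 l) y.
  by move=> sH Dy; apply: (differentiable_mxP _ _).1 (diffE H y sH Dy) _ _.
have cont2 l w w' : {for x, continuous ('D_w ('D_w' (fun z => F z 0 l)))}.
  apply: differentiable_continuous.
  apply: near_eq_differentiable (entry_diff ('D_w ('D_w' F)) l x _ Dx).
    by apply: filterS (near_D x Dx) => z Dz; apply: entry2.
  by do 2 apply: smooth_on_derive.
apply/rowP => l; apply: (etrans (entry2 l u v x Dx)).
apply: (etrans _ (esym (entry2 l v u x Dx))).
apply: (mixed_derive_comm oD Dx) => // [y Dy|w y Dy]; first exact: entry_diff.
apply: near_eq_differentiable (entry_diff ('D_w F) l y _ Dy).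
  by apply: filterS (near_D y Dy) => z Dz; apply: entry1.
exact: smooth_on_derive.
Qed.

(** Linearity in the second argument turns [T y a] into a matrix product [a *m B y], so this is the
    product rule for matrices. *)
Lemma is_derive_row_linear (R : realType) (V : normedModType R) (k l : nat)
    (T : V -> 'rV[R]_k -> 'rV[R]_l) (P : V -> 'rV[R]_k) (x w : V) :
  (\forall y \near x, forall a, T y a = \sum_j a 0 j *: T y (delta_mx 0 j)) ->
  (forall j, differentiable (T ^~ (delta_mx 0 j)) x) -> differentiable P x ->
  differentiable (fun y => T y (P y)) x /\
  'D_w (fun y => T y (P y)) x = 'D_w (T ^~ (P x)) x + T x ('D_w P x).
Proof.
move=> linT dT dP.
pose B y : 'M[R]_(k, l) := \matrix_(j, i) T y (delta_mx 0 j) 0 i.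
have TB : \forall y \near x, forall a, a *m B y = T y a.
  apply: filterS linT => y linTy a; rewrite linTy; apply/rowP => i.
  by rewrite [LHS]mxE summxE; apply: eq_bigr => j _; rewrite !mxE.
have dB : differentiable B x.
  apply/differentiable_mxP => j i; rewrite /B; under eq_fun do rewrite mxE.
  exact: (differentiable_mxP _ _).1 (dT j) _ _.
have near_TB (Q : V -> 'rV[R]_k) : \forall y \near x, Q y *m B y = T y (Q y).
  by apply: filterS TB => y.
have [dPB e] := is_derive_mulmx w dP dB.
(* The product rule with [P] frozen at its value at [x] identifies the term in which only [T] is
   differentiated. *)
have [dcB ec] := is_derive_mulmx w (differentiable_cst (P x) x) dB.
split; first exact: near_eq_differentiable (near_TB P) (differentiable_mulmx dP dB).
rewrite -(near_eq_derive w (near_TB P)) -(near_eq_derive w (near_TB (cst (P x)))).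
rewrite e ec derive_cst mul0mx add0r addrC; congr (_ + _).
by apply: (nbhs_singleton TB).
Qed.

(** * Christoffel symbols along a map *)

Section ChristoffelAlong.
Variables (R : realType) (n m : nat) (W : set 'rV[R]_m).
Variables (G : 'rV[R]_m -> 'M[R]_m).
Hypothesis W_open : open W.
Hypothesis G_smooth : smooth_on W G.
Hypothesis G_unit : forall y, W y -> G y \in unitmx.

Lemma christoffel_linl y a v : W y ->
  christoffel G y a v = \sum_j a 0 j *: christoffel G y (delta_mx 0 j) v.
Proof.
move=> Wy; rewrite -[in LHS](row_delta a) christoffel_suml //.
exact: smooth_on_differentiable G_smooth Wy.
Qed.

Lemma christoffel_linr y u a : W y ->
  christoffel G y u a = \sum_j a 0 j *: christoffel G y u (delta_mx 0 j).
Proof.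
move=> Wy; rewrite -[in LHS](row_delta a) christoffel_sumr //.
exact: smooth_on_differentiable G_smooth Wy.
Qed.

Lemma differentiable_christoffel y u v : W y ->
  differentiable (fun z => christoffel G z u v) y.
Proof.
move=> Wy; apply: differentiable_mulmx; last first.
  apply: differentiable_invmx; last exact: smooth_on_differentiable G_smooth Wy.
  by apply: filterS (open_nbhs_nbhs (conj W_open Wy)) => z; apply: G_unit.
have dDG w a b : differentiable (fun z => inner ('D_w G z) a b) y.
  have dG := smooth_on_differentiable (smooth_on_derive w G_smooth) Wy.
  apply: (differentiable_mxP _ _).1.
  apply: (differentiable_mulmx _ (differentiable_cst _ _)).
  exact: (differentiable_mulmx (differentiable_cst _ _) dG).
apply/differentiable_mxP => i l; under eq_fun do rewrite mxE.
apply: (differentiableM _ (differentiable_cst _ _)).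
exact: (differentiableB (differentiableD (dDG _ _ _) (dDG _ _ _)) (dDG _ _ _)).
Qed.

(** The Leibniz rule for a bilinear expression, obtained by using [is_derive_row_linear] in the
    right slot and then in the left one; the base point moves with [F], whence the chain rule in the
    first term. *)
Lemma derive_christoffel_along (F : 'rV[R]_n -> 'rV[R]_m)
    (P Q : 'rV[R]_n -> 'rV[R]_m) (x w : 'rV[R]_n) :
  W (F x) -> differentiable F x -> differentiable P x -> differentiable Q x ->
  differentiable (fun y => christoffel G (F y) (P y) (Q y)) x /\
  'D_w (fun y => christoffel G (F y) (P y) (Q y)) x =
  'D_('D_w F x) (fun z => christoffel G z (P x) (Q x)) (F x)
  + christoffel G (F x) (P x) ('D_w Q x) + christoffel G (F x) ('D_w P x) (Q x).
Proof.
move=> WFx dF dP dQ.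
have nW : \forall y \near x, W (F y).
  by apply: (differentiable_continuous dF); apply: open_nbhs_nbhs.
have dG u v : differentiable (fun y => christoffel G (F y) u v) x.
  exact: (differentiable_comp dF (differentiable_christoffel u v WFx)).
have linr u : \forall y \near x, forall b, christoffel G (F y) u b =
    \sum_j b 0 j *: christoffel G (F y) u (delta_mx 0 j).
  by apply: filterS nW => y Wy b; apply: christoffel_linr.
have linl : \forall y \near x, forall a, christoffel G (F y) a (Q y) =
    \sum_j a 0 j *: christoffel G (F y) (delta_mx 0 j) (Q y).
  by apply: filterS nW => y Wy a; apply: christoffel_linl.
have rule2 u := is_derive_row_linear w (linr u) (fun j => dG u _) dQ.
have [d ->] := is_derive_row_linear w linl (fun j => (rule2 (delta_mx 0 j)).1) dP.
split=> //; congr (_ + _); rewrite (rule2 (P x)).2; congr (_ + _).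
by rewrite -derive_comp //; apply: differentiable_christoffel.
Qed.

End ChristoffelAlong.

(** * Traceless symmetric matrices *)

Definition dot (R : realType) (n : nat) (u v : 'rV[R]_n) : R := (u *m v^T) 0 0.

Lemma mxtrace_rank1 (R : realType) (n : nat) (u v : 'rV[R]_n) :
  \tr (u^T *m v) = dot v u.
Proof. by rewrite mxtrace_mulC /mxtrace big_ord1. Qed.

Lemma dot_ge0 (R : realType) (n : nat) (u : 'rV[R]_n) : 0 <= dot u u.
Proof.
by rewrite /dot mxE; apply: sumr_ge0 => i _; rewrite mxE -expr2 sqr_ge0.
Qed.

Lemma mxtrace_mulmxT_ge0 (R : realType) (n : nat) (B : 'M[R]_n) :
  0 <= \tr (B *m B^T).
Proof.
apply: sumr_ge0 => i _; rewrite mxE; apply: sumr_ge0 => j _.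
by rewrite mxE -expr2 sqr_ge0.
Qed.

Lemma dotC (R : realType) (n : nat) (u v : 'rV[R]_n) : dot u v = dot v u.
Proof. by rewrite -mxtrace_rank1 -mxtrace_tr trmx_mul trmxK mxtrace_rank1. Qed.

Lemma dotDl (R : realType) (n : nat) (u u' v : 'rV[R]_n) :
  dot (u + u') v = dot u v + dot u' v.
Proof. by rewrite /dot mulmxDl mxE. Qed.

Lemma dotZl (R : realType) (n : nat) k (u v : 'rV[R]_n) :
  dot (k *: u) v = k * dot u v.
Proof. by rewrite /dot -scalemxAl mxE. Qed.

Lemma dotDr (R : realType) (n : nat) (u v v' : 'rV[R]_n) :
  dot u (v + v') = dot u v + dot u v'.
Proof. by rewrite !(dotC u) dotDl. Qed.

Lemma dotZr (R : realType) (n : nat) k (u v : 'rV[R]_n) :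
  dot u (k *: v) = k * dot u v.
Proof. by rewrite !(dotC u) dotZl. Qed.

Lemma dot_unit_le (R : realType) (n : nat) (x y : 'rV[R]_n) :
  dot x x = 1 -> dot y x ^+ 2 <= dot y y.
Proof.
move=> x1; have := dot_ge0 (y + - dot y x *: x).
rewrite !(dotDl, dotDr, dotZl, dotZr) x1 (dotC x y); nra.
Qed.

(* With P the projection onto the orthogonal complement of x, compare the
   compression P phi P, of trace - <phi x, x>, with the multiple of P of the
   same trace. *)
Lemma traceless_le (R : realType) (n : nat) (phi : 'M[R]_n) (x : 'rV[R]_n) :
  (2 <= n)%N -> phi^T = phi -> \tr phi = 0 -> dot x x = 1 ->
  n%:R * dot (x *m phi) (x *m phi) <= (n%:R - 1) * \tr (phi *m phi).
Proof.
move=> n2 sphi tphi x1.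
set a := dot (x *m phi) x; set y2 := dot (x *m phi) (x *m phi).
have n2R : 2 <= n%:R :> R by rewrite ler_nat.
have a2 : a ^+ 2 <= y2 by apply: dot_unit_le.
(* [P *m phi *m P] has trace [- a] and [P] has trace [n - 1], so this [c] makes [P *m psi *m P]
   traceless. *)
pose c := a / (n%:R - 1).
pose psi := phi + c%:M.
pose X := x^T *m x.
pose P := 1%:M - X.
have spsi : psi^T = psi by rewrite /psi linearD /= sphi tr_scalar_mx.
have PT : P^T = P by rewrite /P /X linearB /= trmx1 trmx_mul trmxK.
have XX : X *m X = X.
  have xx : x *m x^T = 1%:M.
    by apply/matrixP => i j; rewrite !ord1 [RHS]mxE eqxx.
  by rewrite /X mulmxA -(mulmxA x^T) xx mulmx1.
have PP : P *m P = P.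
  by rewrite /P mulmxBl mul1mx mulmxBr mulmx1 XX subrr subr0.
have := mxtrace_mulmxT_ge0 (P *m psi *m P).
have -> : \tr (P *m psi *m P *m (P *m psi *m P)^T) = \tr (P *m psi *m (P *m psi)).
  have -> : (P *m psi *m P)^T = P *m psi *m P by rewrite !trmx_mul PT spsi mulmxA.
  have -> : P *m psi *m P *m (P *m psi *m P) = P *m psi *m P *m psi *m P.
    by rewrite !mulmxA -(mulmxA _ P P) PP.
  by rewrite mxtrace_mulC !mulmxA PP.
have -> : P *m psi = psi - X *m psi by rewrite mulmxBl mul1mx.
have xpsi : x *m psi = x *m phi + c *: x by rewrite mulmxDr mul_mx_scalar.
have -> : \tr ((psi - X *m psi) *m (psi - X *m psi)) =
    \tr (psi *m psi) - 2 * dot (x *m psi) (x *m psi) + dot (x *m psi) x ^+ 2.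
  have t1 : \tr (X *m psi *m psi) = dot (x *m psi) (x *m psi).
    by rewrite /X -!mulmxA mxtrace_rank1 /dot trmx_mul spsi !mulmxA.
  have t2 : \tr (psi *m (X *m psi)) = dot (x *m psi) (x *m psi).
    by rewrite mxtrace_mulC.
  have t3 : \tr (X *m psi *m (X *m psi)) = dot (x *m psi) x ^+ 2.
    have -> : X *m psi *m (X *m psi) = x^T *m ((x *m psi *m x^T) *m (x *m psi)).
      by rewrite /X !mulmxA.
    rewrite mxtrace_rank1 (mx11_scalar (x *m psi *m x^T)) mul_scalar_mx dotZl.
    by rewrite expr2.
  by rewrite mulmxBl !mulmxBr !raddfB /= t1 t2 t3; ring.
have -> : \tr (psi *m psi) = \tr (phi *m phi) + c ^+ 2 * n%:R.
  rewrite /psi mulmxDl !mulmxDr !mul_mx_scalar !mul_scalar_mx !raddfD /=.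
  by rewrite !mxtraceZ tphi mxtrace_scalar -mulr_natr; ring.
rewrite xpsi !(dotDl, dotDr, dotZl, dotZr) x1 (dotC x) -/a -/y2.
move: (\tr _) => s.
have n1 : 0 < n%:R - 1 :> R by lra.
set l := (X in 0 <= X).
have -> : l = s - 2 * y2 + (n%:R - 2) * a ^+ 2 / (n%:R - 1).
  by rewrite /l /c; field; rewrite gt_eqF.
move=> h0; have : 0 <= (n%:R - 1) * (s - 2 * y2 + (n%:R - 2) * a ^+ 2 / (n%:R - 1)).
  by rewrite mulr_ge0 // ltW.
have -> : (n%:R - 1) * (s - 2 * y2 + (n%:R - 2) * a ^+ 2 / (n%:R - 1)) =
    (n%:R - 1) * (s - 2 * y2) + (n%:R - 2) * a ^+ 2.
  by field; rewrite gt_eqF.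
(* Replacing [a ^+ 2] by the larger [y2] turns the coefficient of [y2] into
   [- 2 (n - 1) + (n - 2) = - n]. *)
have : 0 <= (n%:R - 2) * (y2 - a ^+ 2) by rewrite mulr_ge0 // subr_ge0.
lra.
Qed.

(** * Lower bound for a family of symmetric matrices *)

Lemma sum_mul_sqr_le (R : realType) (I : finType) (h al : I -> R) :
  (\sum_i h i * al i) ^+ 2 <= (\sum_i h i ^+ 2) * (\sum_i al i ^+ 2).
Proof.
have expand p q : \sum_i (p * al i - q * h i) ^+ 2 =
    p ^+ 2 * (\sum_i al i ^+ 2) - 2 * p * q * (\sum_i h i * al i)
    + q ^+ 2 * (\sum_i h i ^+ 2).
  rewrite !mulr_sumr -sumrB -big_split /=.
  by apply: eq_bigr => i _; ring.
move: expand; set D := \sum_i (h i * _); set A := \sum_i h i ^+ 2; set C := \sum_i _.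
move=> expand.
have A0 : 0 <= A by apply: sumr_ge0 => i _; apply: sqr_ge0.
have [Az|An0] := eqVneq A 0.
  have hz i : h i = 0.
    move/eqP: Az; rewrite psumr_eq0 => [|j _]; last exact: sqr_ge0.
    by move=> /allP /(_ i); rewrite mem_index_enum sqrf_eq0 => /(_ isT) /eqP.
  by rewrite /D big1 => [|i _]; rewrite ?hz ?mul0r // Az mul0r expr0n.
have Agt : 0 < A by rewrite lt_def An0.
(* For [p = A] and [q = D] the expansion is [A] times the gap in the Cauchy-Schwarz inequality. *)
have : 0 <= \sum_i (A * al i - D * h i) ^+ 2 by apply: sumr_ge0 => i _; apply: sqr_ge0.
rewrite expand (_ : _ + _ = A * (A * C - D ^+ 2)); last by ring.
by rewrite pmulr_rge0 // subr_ge0.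
Qed.

Lemma leung_inequality_unit (R : realType) (n k : nat) (B : 'I_k -> 'M[R]_n)
    (x : 'rV[R]_n) (S H : R) :
  (2 <= n)%N -> (forall a, (B a)^T = B a) -> dot x x = 1 -> 0 <= H ->
  S = \sum_a \tr (B a *m B a) -> n%:R ^+ 2 * H ^+ 2 = \sum_a \tr (B a) ^+ 2 ->
  - ((n%:R - 1) / n%:R)
    * (S + n%:R * (n%:R - 2) / Num.sqrt (n%:R * (n%:R - 1))
             * H * Num.sqrt (S - n%:R * H ^+ 2)
         - 2 * n%:R * H ^+ 2)
  <= \sum_a (\tr (B a) * dot (x *m B a) x - dot (x *m B a) (x *m B a)).
Proof.
move=> n2 sB x1 H0 eS eH.
have n2R : 2 <= n%:R :> R by rewrite ler_nat.
have n0 : n%:R != 0 :> R by rewrite gt_eqF //; lra.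
pose h a := \tr (B a) / n%:R.
pose phi a := B a - (h a)%:M.
pose y2 a := dot (x *m phi a) (x *m phi a).
pose al a := dot (x *m phi a) x.
pose s a := \tr (phi a *m phi a).
have y2_le a : n%:R * y2 a <= (n%:R - 1) * s a.
  apply: traceless_le => //; first by rewrite /phi linearB /= sB tr_scalar_mx.
  by rewrite /phi raddfB /= mxtrace_scalar -mulr_natr /h divfK ?subrr.
have al_le a : al a ^+ 2 <= y2 a by apply: dot_unit_le.
have sE a : s a = \tr (B a *m B a) - n%:R * h a ^+ 2.
  rewrite /s /phi mulmxBl !mulmxBr !mul_mx_scalar !mul_scalar_mx !raddfB /=.
  by rewrite !mxtraceZ mxtrace_scalar -mulr_natr /h; field.
have H2 : H ^+ 2 = \sum_a h a ^+ 2.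
  apply: (@mulfI _ (n%:R ^+ 2)); first by rewrite expf_neq0.
  rewrite eH mulr_sumr; apply: eq_bigr => a _; rewrite /h; by field.
pose Phi := \sum_a s a.
have PhiE : S - n%:R * H ^+ 2 = Phi.
  by rewrite eS H2 mulr_sumr -sumrB; apply: eq_bigr => a _; rewrite sE.
have s0 a : 0 <= s a.
  have y20 : 0 <= y2 a by apply: dot_ge0.
  by rewrite -(@pmulr_rge0 _ (n%:R - 1)) ?(le_trans _ (y2_le a)) ?mulr_ge0 //; lra.
have Phi0 : 0 <= Phi by apply: sumr_ge0.
have termE a : \tr (B a) * dot (x *m B a) x - dot (x *m B a) (x *m B a) =
    (n%:R - 1) * h a ^+ 2 + (n%:R - 2) * (h a * al a) - y2 a.
  have xB : x *m B a = x *m phi a + h a *: x.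
    by rewrite /phi mulmxBr mul_mx_scalar subrK.
  rewrite xB !(dotDl, dotDr, dotZl, dotZr) x1 (dotC x) -/(al a) -/(y2 a).
  have -> : \tr (B a) = h a * n%:R by rewrite /h divfK.
  ring.
under eq_bigr do rewrite termE.
rewrite sumrB big_split -!mulr_sumr /= -H2.
set D := \sum_a (h a * al a).
have sum_y2 : n%:R * (\sum_a y2 a) <= (n%:R - 1) * Phi.
  by rewrite !mulr_sumr; apply: ler_sum.
have sum_al : \sum_a al a ^+ 2 <= \sum_a y2 a by apply: ler_sum.
have D2 : D ^+ 2 <= H ^+ 2 * (\sum_a y2 a).
  apply: le_trans (sum_mul_sqr_le h al) _.
  by rewrite -H2 ler_wpM2l // sqr_ge0.
rewrite PhiE (_ : S = Phi + n%:R * H ^+ 2); last by rewrite -PhiE subrK.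
set r := Num.sqrt (n%:R * (n%:R - 1)).
have r2 : r ^+ 2 = n%:R * (n%:R - 1) by rewrite sqr_sqrtr // mulr_ge0 //; lra.
have r0 : 0 < r by rewrite sqrtr_gt0 mulr_gt0 //; lra.
set q := Num.sqrt Phi.
have q0 : 0 <= q by apply: sqrtr_ge0.
have q2 : q ^+ 2 = Phi by rewrite sqr_sqrtr.
(* The square of [(n - 1) / r] is [(n - 1) / n], so the bound on [D] combines Cauchy-Schwarz ([D2])
   with the summed traceless inequality ([sum_y2]). *)
have D_ge : - ((n%:R - 1) / r * H * q) <= D.
  have : `|D| <= (n%:R - 1) / r * H * q.
    have c0 : 0 <= (n%:R - 1) / r * H * q.
      by rewrite !mulr_ge0 // ?invr_ge0 ?(ltW r0) //; lra.
    rewrite -(ger0_norm c0) -ler_sqr ?nnegrE // -!normrX.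
    rewrite !ger0_norm ?sqr_ge0 //; apply: le_trans D2 _.
    rewrite !exprMn exprVn r2 q2.
    have -> : (n%:R - 1) ^+ 2 * (n%:R * (n%:R - 1))^-1 * H ^+ 2 * Phi =
        H ^+ 2 * ((n%:R - 1) * Phi / n%:R).
      have n10 : n%:R - 1 != 0 :> R by rewrite gt_eqF //; lra.
      by field; rewrite n0 n10.
    rewrite ler_wpM2l ?sqr_ge0 // ler_pdivlMr; last by lra.
    by rewrite mulrC.
  by rewrite ler_norml => /andP[].
(* Now each of the three terms faces its counterpart in the sum of [termE]: the first are equal, the
   second compare by [D_ge] since [n - 2] is nonnegative, the third by [sum_y2]. *)
have -> : - ((n%:R - 1) / n%:R) * (Phi + n%:R * H ^+ 2
      + n%:R * (n%:R - 2) / r * H * q - 2 * n%:R * H ^+ 2) =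
    (n%:R - 1) * H ^+ 2 + (n%:R - 2) * - ((n%:R - 1) / r * H * q)
    - (n%:R - 1) * Phi / n%:R.
  by field; rewrite n0 gt_eqF.
apply: lerB; last by rewrite ler_pdivlMr 1?mulrC //; lra.
by rewrite lerD2l ler_wpM2l //; lra.
Qed.

(** Both sides are homogeneous of degree two in [x], so a nonzero [x] is rescaled to a unit
    vector. *)
Lemma leung_inequality (R : realType) (n k : nat) (B : 'I_k -> 'M[R]_n)
    (x : 'rV[R]_n) (S H : R) :
  (2 <= n)%N -> (forall a, (B a)^T = B a) -> 0 <= H ->
  S = \sum_a \tr (B a *m B a) -> n%:R ^+ 2 * H ^+ 2 = \sum_a \tr (B a) ^+ 2 ->
  - ((n%:R - 1) / n%:R)
    * (S + n%:R * (n%:R - 2) / Num.sqrt (n%:R * (n%:R - 1))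
             * H * Num.sqrt (S - n%:R * H ^+ 2)
         - 2 * n%:R * H ^+ 2)
    * dot x x
  <= \sum_a (\tr (B a) * dot (x *m B a) x - dot (x *m B a) (x *m B a)).
Proof.
move=> n2 sB H0 eS eH.
have [x0|x0] := eqVneq (dot x x) 0.
  rewrite x0 mulr0; have -> : x = 0.
    apply/rowP => i; rewrite [RHS]mxE; apply/eqP; rewrite -sqrf_eq0 expr2; move: x0.
    rewrite /dot mxE => /eqP; rewrite psumr_eq0 => [/allP/(_ i)|j _].
      by rewrite mem_index_enum mxE => /(_ isT).
    by rewrite mxE -expr2 sqr_ge0.
  by rewrite big1 // => a _; rewrite mul0mx /dot mul0mx mxE mulr0 subrr.
have xpos : 0 < dot x x by rewrite lt_def x0 dot_ge0.
pose r := Num.sqrt (dot x x); pose y := r^-1 *: x.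
have r0 : r != 0 by rewrite gt_eqF // sqrtr_gt0.
have r2 : r ^+ 2 = dot x x by rewrite sqr_sqrtr // ltW.
have xE : x = r *: y by rewrite /y scalerA mulfV // scale1r.
have y1 : dot y y = 1.
  by rewrite /y dotZl dotZr -r2; field.
have -> : \sum_a (\tr (B a) * dot (x *m B a) x - dot (x *m B a) (x *m B a)) =
    (\sum_a (\tr (B a) * dot (y *m B a) y - dot (y *m B a) (y *m B a))) * dot x x.
  rewrite mulr_suml; apply: eq_bigr => a _.
  rewrite -r2 xE -!scalemxAl !(dotZl, dotZr); ring.
by rewrite ler_wpM2r ?dot_ge0 //; apply: leung_inequality_unit.
Qed.

(** * The Gauss equation in coordinates *)

Lemma innerNl (R : realType) (n : nat) (G : 'M[R]_n) u v :
  inner G (- u) v = - inner G u v.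
Proof. by rewrite -scaleN1r innerZl mulN1r. Qed.

(** Metric compatibility of the connection pulled back by [F]: the derivative of [G \o F] is that of
    [G] in the direction ['D_v F x], to which the characterization of the Levi-Civita connection
    applies. *)
Lemma derive_inner_along (R : realType) (n m : nat) (G : 'rV[R]_m -> 'M[R]_m)
    (F P Q : 'rV[R]_n -> 'rV[R]_m) (x v : 'rV[R]_n) :
  differentiable G (F x) -> (\forall y \near F x, (G y)^T = G y) ->
  (forall u, u != 0 -> 0 < inner (G (F x)) u u) ->
  differentiable F x -> differentiable P x -> differentiable Q x ->
  'D_v (fun y => inner (G (F y)) (P y) (Q y)) x =
  inner (G (F x)) (nabla G F P v x) (Q x) + inner (G (F x)) (P x) (nabla G F Q v x).
Proof.
move=> dG sG pG dF dP dQ.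
have [_ mc] := (levi_civitaP dG sG pG _).2 erefl.
have dGF := differentiable_comp dF dG.
have [_ ->] := is_derive_inner v dGF dP dQ.
have -> : 'D_v (G \o F) x = 'D_('D_v F x) G (F x) by apply: derive_comp.
rewrite /comp mc /nabla innerDl innerDr.
have reorder (a b c d : R) : a + b + c + d = (c + a) + (d + b) by ring.
exact: reorder.
Qed.

Lemma nabla_cst (R : realType) (n : nat) (G : 'rV[R]_n -> 'M[R]_n)
    (w u x : 'rV[R]_n) :
  nabla G id (cst w) u x = christoffel G x u w.
Proof. by rewrite /nabla derive_cst add0r derive_id. Qed.

Lemma curvature_op_cst (R : realType) (n : nat) (G : 'rV[R]_n -> 'M[R]_n)
    (u v w x : 'rV[R]_n) :
  differentiable G x ->
  curvature_op G (cst u) (cst v) (cst w) x =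
  nabla G id (fun y => christoffel G y u w) v x
  - nabla G id (fun y => christoffel G y v w) u x.
Proof.
move=> dG.
have br0 : bracket (cst u) (cst v) x = 0 by rewrite /bracket !derive_cst subrr.
have c0 : nabla G id (cst w) (bracket (cst u) (cst v) x) x = 0.
  rewrite br0 nabla_cst.
  (* The zero direction is seen as an empty linear combination. *)
  have := christoffel_suml w (fun _ : 'I_0 => 0) (fun _ => 0) dG.
  by rewrite !big_ord0.
have e a b : nabla G id (fun y => nabla G id (cst w) a y) b x =
    nabla G id (fun y => christoffel G y a w) b x.
  by congr (nabla G id _ b x); apply/funext => y; rewrite nabla_cst.
apply: (etrans (congr2 +%R (congr2 (fun p q => p - q) (e u v) (e v u)) c0)).
exact: addr0.
Qed.

Lemma innerBl (R : realType) (n : nat) (G : 'M[R]_n) u u' v :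
  inner G (u - u') v = inner G u v - inner G u' v.
Proof. by rewrite innerDl innerNl. Qed.

(** Parseval's identity. With the frame as the rows of [M], orthonormality says that [G *m M^T] is a
    right inverse of [M]; as the frame has full length it is also a left inverse. *)
Lemma orthonormal_inner (R : realType) (r m : nat) (G : 'M[R]_m)
    (t : 'I_r -> 'rV[R]_m) (P Q : 'rV[R]_m) :
  r = m -> G^T = G -> (forall i j, inner G (t i) (t j) = (i == j)%:R) ->
  inner G P Q = \sum_i inner G P (t i) * inner G Q (t i).
Proof.
move=> rm sG ot; pose M : 'M[R]_(r, m) := \matrix_i t i.
have rowE (A : 'rV[R]_m) i : inner G A (t i) = (A *m G *m M^T) 0 i.
  rewrite -[t i](rowK t i) -/M /inner tr_row [RHS]mxE [LHS]mxE.
  by apply: eq_bigr => k _; rewrite [in RHS]mxE !mxE.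
have MG : M *m (G *m M^T) = 1%:M.
  apply/matrixP => i j; rewrite mulmxA [RHS]mxE -ot rowE -(rowK t i) -/M.
  by rewrite -!row_mul [RHS]mxE.
have GM : G *m M^T *m M = 1%:M.
  by clear rowE; subst r; apply: mulmx1C.
transitivity ((P *m G *m M^T *m (Q *m G *m M^T)^T) 0 0).
  rewrite !trmx_mul trmxK sG.
  have -> : P *m G *m M^T *m (M *m (G *m Q^T)) = P *m (G *m M^T *m M) *m (G *m Q^T).
    by rewrite !mulmxA.
  by rewrite GM mulmx1 mulmxA.
by rewrite [LHS]mxE; apply: eq_bigr => i _; rewrite !rowE [X in _ * X]mxE.
Qed.

(** [M] has a right inverse, which bounds its number of rows. Applied to the image of a tangent
    frame, this yields [n <= m]. *)
Lemma orthonormal_leq (R : realType) (r m : nat) (G : 'M[R]_m)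
    (t : 'I_r -> 'rV[R]_m) :
  (forall i j, inner G (t i) (t j) = (i == j)%:R) -> (r <= m)%N.
Proof.
move=> ot; pose M : 'M[R]_(r, m) := \matrix_i t i.
apply: (@mulmx1_min R r m M (G *m M^T)).
apply/matrixP => i j; rewrite mulmxA [RHS]mxE -ot /inner.
rewrite -(rowK t i) -(rowK t j) -/M tr_row -row_mul.
rewrite [RHS]mxE [LHS]mxE; apply: eq_bigr => k _.
by rewrite !mxE.
Qed.

(** The trace is invariant under conjugation: [g *m E^T] inverts [E], and the diagonal of
    [E *m A *m g *m E^T] consists of the [inner g (T (e i)) (e i)]. *)
Lemma frame_trace (R : realType) (n : nat) (g : 'M[R]_n) (e : 'I_n -> 'rV[R]_n)
    (T : 'rV[R]_n -> 'rV[R]_n) :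
  (forall i j, inner g (e i) (e j) = (i == j)%:R) ->
  (forall v, T v = \sum_j v 0 j *: T (delta_mx 0 j)) ->
  \sum_i (T (delta_mx 0 i)) 0 i = \sum_i inner g (T (e i)) (e i).
Proof.
move=> oe linT; pose E : 'M[R]_n := \matrix_i e i.
pose A : 'M[R]_n := \matrix_i T (delta_mx 0 i).
have TA v : T v = v *m A.
  rewrite linT; apply/rowP => l; rewrite summxE [RHS]mxE.
  by apply: eq_bigr => j _; rewrite !mxE.
have Eij (C : 'M[R]_n) i j : (E *m C *m E^T) i j = (e i *m C *m (e j)^T) 0 0.
  rewrite -(rowK e i) -(rowK e j) -/E tr_row -row_mul [RHS]mxE [LHS]mxE.
  by apply: eq_bigr => k _; rewrite !mxE.
have EgE : E *m (g *m E^T) = 1%:M.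
  by apply/matrixP => i j; rewrite mulmxA Eij [RHS]mxE -oe.
transitivity (\tr A); first by apply: eq_bigr => i _; rewrite [RHS]mxE.
rewrite -[A]mulmx1 -(mulmx1C EgE) !mulmxA mxtrace_mulC !mulmxA.
rewrite -(mulmxA E A g) /mxtrace; apply: eq_bigr => i _.
by rewrite Eij TA /inner mulmxA.
Qed.

(** Linearity in the slot over which the Ricci trace runs, so that [frame_trace] applies. In one
    term [v] is a direction of differentiation; in the other it is an argument being differentiated,
    which calls for linearity at all points near [x]. *)
Lemma curvature_op_linear (R : realType) (n : nat) (U : set 'rV[R]_n)
    (g : 'rV[R]_n -> 'M[R]_n) (u v w x : 'rV[R]_n) :
  open U -> smooth_on U g -> (forall y, U y -> g y \in unitmx) -> U x ->
  curvature_op g (cst u) (cst v) (cst w) x =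
  \sum_j v 0 j *: curvature_op g (cst u) (cst (delta_mx 0 j)) (cst w) x.
Proof.
move=> oU sg ug Ux.
have dg : differentiable g x by apply: smooth_on_differentiable sg Ux.
have dGamma a b : differentiable (fun y => christoffel g y a b) x.
  exact: (differentiable_christoffel oU sg ug).
pose T1 a := nabla g id (fun y => christoffel g y u w) a x.
pose T2 a := nabla g id (fun y => christoffel g y a w) u x.
have lin1 : T1 v = \sum_j v 0 j *: T1 (delta_mx 0 j).
  have e a : T1 a = 'D_a (fun y => christoffel g y u w) x
      + christoffel g x a (christoffel g x u w) by rewrite /T1 /nabla derive_id.
  rewrite e; under eq_bigr do rewrite e scalerDr.
  rewrite big_split; congr (_ + _); last exact: christoffel_linl sg _ _ _ Ux.
  rewrite -[in LHS](row_delta v).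
  exact: (derive_lin (v 0) (fun j => delta_mx 0 j) (dGamma u w)).
have lin2 : T2 v = \sum_j v 0 j *: T2 (delta_mx 0 j).
  have e a : T2 a = 'D_u (fun y => christoffel g y a w) x
      + christoffel g x u (christoffel g x a w) by rewrite /T2 /nabla derive_id.
  rewrite e; under eq_bigr do rewrite e scalerDr.
  rewrite big_split; congr (_ + _).
    transitivity ('D_u (fun y => \sum_j v 0 j *: christoffel g y (delta_mx 0 j) w) x).
      apply: near_eq_derive; apply: filterS (open_nbhs_nbhs (conj oU Ux)) => y Uy.
      exact: christoffel_linl sg _ _ _ Uy.
    rewrite (@derive_sum_scale _ _ _ _ x u (fun j => cst (v 0 j))
      (fun j y => christoffel g y (delta_mx 0 j) w)) => [|j|j].
    - by apply: eq_bigr => j _; rewrite derive_cst scale0r add0r.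
    - exact: derivable_cst.
    - exact: diff_derivable.
  rewrite (christoffel_linl sg v w Ux).
  exact: (christoffel_sumr u (v 0) (fun j => christoffel g x (delta_mx 0 j) w) dg).
apply: (etrans (curvature_op_cst u v w dg)).
apply: (etrans (congr2 (fun p q => p - q) lin1 lin2)).
rewrite -sumrB; apply: eq_bigr => j _; rewrite -scalerBr; congr (_ *: _).
exact: (esym (curvature_op_cst u (delta_mx 0 j) w dg)).
Qed.

(** * The second derivative of an isometric immersion and its curvature identity *)

Section Gauss.
Variables (R : realType) (n m : nat) (U : set 'rV[R]_n) (W : set 'rV[R]_m).
Variables (F : 'rV[R]_n -> 'rV[R]_m).
Variables (g : 'rV[R]_n -> 'M[R]_n) (G : 'rV[R]_m -> 'M[R]_m).
Hypotheses (U_open : open U) (W_open : open W).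
Hypothesis F_smooth : smooth_on U F.
Hypothesis F_W : forall y, U y -> W (F y).
Hypotheses (g_smooth : smooth_on U g) (G_smooth : smooth_on W G).
Hypothesis g_sym : forall y, U y -> (g y)^T = g y.
Hypothesis G_sym : forall y, W y -> (G y)^T = G y.
Hypothesis g_pos : forall y u, U y -> u != 0 -> 0 < inner (g y) u u.
Hypothesis G_pos : forall y u, W y -> u != 0 -> 0 < inner (G y) u u.
Hypothesis F_isometric : forall y u v, U y ->
  inner (G (F y)) ('D_u F y) ('D_v F y) = inner (g y) u v.

Let hess u v := nabla G F ('D_v F) u.

Let near_U y : U y -> \forall z \near y, U z.
Proof. by move=> Uy; apply: open_nbhs_nbhs. Qed.

Let near_W y : W y -> \forall z \near y, W z.
Proof. by move=> Wy; apply: open_nbhs_nbhs. Qed.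

Let dF y : U y -> differentiable F y.
Proof. exact: smooth_on_differentiable. Qed.

Let dDF u y : U y -> differentiable ('D_u F) y.
Proof. by apply: smooth_on_differentiable; apply: smooth_on_derive. Qed.

Let dg y : U y -> differentiable g y.
Proof. exact: smooth_on_differentiable. Qed.

Let dG y : W y -> differentiable G y.
Proof. exact: smooth_on_differentiable. Qed.

Let LC_G y : W y -> torsion_free_metric G y (christoffel G y).
Proof.
move=> Wy; apply/levi_civitaP => //; first exact: dG.
- by apply: filterS (near_W Wy) => z; apply: G_sym.
- by move=> u; apply: G_pos.
Qed.

Let G_unit y : W y -> G y \in unitmx.
Proof. by move=> Wy; apply: posdef_unitmx => u; apply: G_pos. Qed.

Let g_unit y : U y -> g y \in unitmx.
Proof. by move=> Uy; apply: posdef_unitmx => u; apply: g_pos. Qed.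

(** Symmetry of second derivatives together with vanishing torsion; the symmetry of the second
    fundamental form is its normal part. *)
Lemma nabla_derive_sym u v y : U y ->
  nabla G F ('D_v F) u y = nabla G F ('D_u F) v y.
Proof.
move=> Uy; rewrite /nabla (smooth_derive_comm u v U_open F_smooth Uy).
by rewrite ((LC_G (F_W Uy)).1 ('D_u F y)).
Qed.

Let compat_F P Q v y : U y -> differentiable P y -> differentiable Q y ->
  'D_v (fun z => inner (G (F z)) (P z) (Q z)) y =
  inner (G (F y)) (nabla G F P v y) (Q y) + inner (G (F y)) (P y) (nabla G F Q v y).
Proof.
move=> Uy dP dQ; apply: derive_inner_along => //.
- by apply: dG; apply: F_W.
- by apply: filterS (near_W (F_W Uy)) => z; apply: G_sym.
- by move=> u; apply: G_pos; apply: F_W.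
- exact: dF.
Qed.

(** Koszul's argument: differentiating the isometry relation writes each derivative of [g] as two
    products with second derivatives of [F], and their symmetry isolates a single product. *)
Lemma nabla_derive_tangent u v w y : U y ->
  inner (G (F y)) (nabla G F ('D_v F) u y) ('D_w F y) =
  inner (g y) (christoffel g y u v) w.
Proof.
move=> Uy.
have Dg a b c : inner ('D_a g y) b c =
    inner (G (F y)) (hess a b y) ('D_c F y) + inner (G (F y)) ('D_b F y) (hess a c y).
  rewrite -compat_F //; try exact: dDF.
  have [_ e] := is_derive_inner a (dg Uy) (differentiable_cst b y) (differentiable_cst c y).
  rewrite !derive_cst inner0l addr0 in e.
  have -> : inner ('D_a g y) b c = 'D_a (fun z => inner (g z) b c) y.
    rewrite e; suff -> : inner (g y) b 0 = 0 by rewrite addr0.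
    by rewrite -(scale0r 0) innerZr mul0r.
  apply: near_eq_derive; apply: filterS (near_U Uy) => z Uz.
  by rewrite F_isometric.
have sGF a b : inner (G (F y)) a b = inner (G (F y)) b a.
  by apply: innerC; apply: G_sym; apply: F_W.
(* In [p + q - r] the pairs [b], [t] and [s], [e] cancel, while [a] and [c] coincide. *)
have sym3 (p q r a b c s t e : R) : p = a + b -> q = c + s -> r = t + e ->
    c = a -> t = b -> e = s -> a = (p + q - r) / 2.
  by move=> -> -> -> -> -> ->; field.
rewrite (koszul (dg Uy) (fun a => g_pos Uy)).
apply: (sym3 _ _ _ _ _ _ _ _ _ (Dg u v w) (Dg v u w) (Dg w u v)).
- by rewrite /hess (nabla_derive_sym v u Uy).
- by rewrite sGF /hess (nabla_derive_sym w u Uy).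
- by rewrite /hess (nabla_derive_sym w v Uy).
Qed.

Let d_hess u v y : U y -> differentiable (hess u v) y.
Proof.
move=> Uy; apply: differentiableD.
  by apply: smooth_on_differentiable Uy; do 2 apply: smooth_on_derive.
apply: (derive_christoffel_along W_open G_smooth G_unit 0 _ _ _ _).1.
- exact: F_W.
- exact: dF.
- exact: dDF.
- exact: dDF.
Qed.

(** The curvature of the pulled-back connection is the ambient curvature on the image vectors: all
    terms with second or third derivatives of [F] drop out of the commutator. *)
Lemma nabla_nabla_derive u v w x : U x ->
  nabla G F (nabla G F ('D_w F) u) v x - nabla G F (nabla G F ('D_w F) v) u x =
  curvature_op G (cst ('D_u F x)) (cst ('D_v F x)) (cst ('D_w F x)) (F x).
Proof.
move=> Ux; have WFx := F_W Ux.
rewrite curvature_op_cst; last exact: dG.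
have expand a b : nabla G F (nabla G F ('D_w F) a) b x =
    'D_b ('D_a ('D_w F)) x
    + ('D_('D_b F x) (fun z => christoffel G z ('D_a F x) ('D_w F x)) (F x)
       + christoffel G (F x) ('D_a F x) ('D_b ('D_w F) x)
       + christoffel G (F x) ('D_b ('D_a F) x) ('D_w F x))
    + (christoffel G (F x) ('D_b F x) ('D_a ('D_w F) x)
       + christoffel G (F x) ('D_b F x)
           (christoffel G (F x) ('D_a F x) ('D_w F x))).
  have [dc ec] := derive_christoffel_along W_open G_smooth G_unit b WFx
    (dF Ux) (dDF a Ux) (dDF w Ux).
  have dDDF : differentiable ('D_a ('D_w F)) x.
    by apply: smooth_on_differentiable Ux; do 2 apply: smooth_on_derive.
  have addr_christoffel p q r : christoffel G (F x) p (q + r) =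
      christoffel G (F x) p q + christoffel G (F x) p r.
    rewrite !(christoffel_linr G_smooth p _ WFx) -big_split /=.
    by apply: eq_bigr => j _; rewrite mxE scalerDl.
  have eD := deriveD (diff_derivable (v := b) dDDF) (diff_derivable (v := b) dc).
  apply: (congr2 +%R); last exact: addr_christoffel.
  by apply: (etrans eD); congr (_ + _); apply: ec.
(* [X] and [s] are symmetric in [u] and [v], whereas [p] and [q] trade places when the two are
   exchanged; only derivatives and products of Christoffel symbols survive. *)
have cancel (X X' K K' s s' p q c c' : 'rV[R]_m) : X = X' -> s = s' ->
    X + (K + p + s) + (q + c) - (X' + (K' + q + s') + (p + c')) = K + c - (K' + c').
  by move=> -> ->; apply/rowP => i; rewrite !mxE; ring.
have nabla_id a b : nabla G id (fun z => christoffel G z a ('D_w F x)) b (F x) =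
    'D_b (fun z => christoffel G z a ('D_w F x)) (F x)
    + christoffel G (F x) b (christoffel G (F x) a ('D_w F x)).
  by rewrite /nabla derive_id.
pose minus (p q : 'rV[R]_m) := p - q.
apply: (etrans (congr2 minus (expand u v) (expand v u))).
apply: (etrans _ (esym (congr2 minus (nabla_id _ _) (nabla_id _ _)))).
apply: cancel.
  exact: smooth_derive_comm U_open (smooth_on_derive w F_smooth) Ux.
by rewrite (smooth_derive_comm v u U_open F_smooth Ux).
Qed.

(* Differentiate [nabla_derive_tangent] along a second direction and
   antisymmetrize. *)
Lemma gauss_equation u v w z x : U x ->
  inner (g x) (curvature_op g (cst u) (cst v) (cst w) x) z =
  inner (G (F x)) (curvature_op G (cst ('D_u F x)) (cst ('D_v F x))
                     (cst ('D_w F x)) (F x)) ('D_z F x)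
  + inner (G (F x)) (nabla G F ('D_w F) u x) (nabla G F ('D_z F) v x)
  - inner (G (F x)) (nabla G F ('D_w F) v x) (nabla G F ('D_z F) u x)
  - (inner (g x) (christoffel g x u w) (christoffel g x v z)
     - inner (g x) (christoffel g x v w) (christoffel g x u z)).
Proof.
move=> Ux.
have key a b : inner (G (F x)) (nabla G F (nabla G F ('D_w F) a) b x) ('D_z F x)
    + inner (G (F x)) (nabla G F ('D_w F) a x) (nabla G F ('D_z F) b x) =
    inner (g x) (nabla g id (fun y => christoffel g y a w) b x) z
    + inner (g x) (christoffel g x a w) (christoffel g x b z).
  apply: (etrans (esym (compat_F b Ux (d_hess a w Ux) (dDF z Ux)))).
  have dGamma : differentiable (fun y => christoffel g y a w) x.
    exact: (differentiable_christoffel U_open g_smooth g_unit).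
  have sg : \forall y \near x, (g y)^T = g y.
    by apply: filterS (near_U Ux) => y; apply: g_sym.
  have compat_g := derive_inner_along b (F := id) (dg Ux) sg (fun c => g_pos Ux)
    (ex_diff (is_diff_def := is_diff_id x)) dGamma (differentiable_cst z x).
  rewrite nabla_cst in compat_g; apply: (etrans _ compat_g).
  apply: near_eq_derive; apply: filterS (near_U Ux) => y Uy.
  exact: nabla_derive_tangent.
have lhs := congr1 (fun p => inner (g x) p z) (curvature_op_cst u v w (dg Ux)).
have rhs := congr1 (fun p => inner (G (F x)) p ('D_z F x)) (nabla_nabla_derive u v w Ux).
have solve (l r a b a' b' h h' c c' : R) : l = a - b -> a' - b' = r ->
    a' + h = a + c -> b' + h' = b + c' -> l = r + h - h' - (c - c').
  by move=> -> <-; lra.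
apply: solve (key u v) (key v u).
- by apply: (etrans lhs); apply: innerBl.
- by apply: (etrans _ rhs); apply/esym; apply: innerBl.
Qed.

(** * Splitting along orthonormal frames at one point *)

Section Frame.
Variables (x : 'rV[R]_n) (e : 'I_n -> 'rV[R]_n) (k : nat) (nu : 'I_k -> 'rV[R]_m).
Hypothesis Ux : U x.
(** The number of normals will be the truncated difference [m - n], for which the equality
    presupposes [n <= m]; that bound is derived in [tangent_normal_inner]. *)
Hypothesis km : (n <= m)%N -> (n + k = m)%N.
Hypothesis e_orthonormal : forall i j, inner (g x) (e i) (e j) = (i == j)%:R.
Hypothesis nu_normal : forall a u, inner (G (F x)) ('D_u F x) (nu a) = 0.
Hypothesis nu_orthonormal : forall a a', inner (G (F x)) (nu a) (nu a') = (a == a')%:R.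

Let WFx : W (F x) := F_W Ux.

Lemma tangent_normal_inner P Q :
  inner (G (F x)) P Q =
  \sum_i inner (G (F x)) P ('D_(e i) F x) * inner (G (F x)) Q ('D_(e i) F x)
  + \sum_a inner (G (F x)) P (nu a) * inner (G (F x)) Q (nu a).
Proof.
pose t (i : 'I_(n + k)) := match fintype.split i with
  inl j => 'D_(e j) F x | inr a => nu a end.
have tl i : t (lshift k i) = 'D_(e i) F x by rewrite /t (unsplitK (inl i)).
have tr a : t (rshift n a) = nu a by rewrite /t (unsplitK (inr a)).
have oF i j : inner (G (F x)) ('D_(e i) F x) ('D_(e j) F x) = (i == j)%:R.
  by rewrite F_isometric.
have ot i j : inner (G (F x)) (t i) (t j) = (i == j)%:R.
  case: (split_ordP i) => a ->; case: (split_ordP j) => b ->; rewrite ?tl ?tr.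
  - by rewrite oF eq_lshift.
  - by rewrite nu_normal eq_lrshift.
  - by rewrite (innerC _ _ (G_sym WFx)) nu_normal eq_rlshift.
  - by rewrite nu_orthonormal eq_rshift.
have nkm : (n + k = m)%N by apply: km; apply: orthonormal_leq oF.
rewrite (orthonormal_inner P Q nkm (G_sym WFx) ot) big_split_ord /=.
by congr (_ + _); apply: eq_bigr => i _; rewrite ?tl ?tr.
Qed.

(** By [nabla_derive_tangent], the tangential parts of the products of second derivatives in
    [gauss_equation] are exactly its Christoffel products, so only normal components remain. *)
Lemma gauss_normal u v w z :
  inner (g x) (curvature_op g (cst u) (cst v) (cst w) x) z =
  inner (G (F x)) (curvature_op G (cst ('D_u F x)) (cst ('D_v F x))
                     (cst ('D_w F x)) (F x)) ('D_z F x)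
  + \sum_a (inner (G (F x)) (nabla G F ('D_w F) u x) (nu a)
            * inner (G (F x)) (nabla G F ('D_z F) v x) (nu a)
            - inner (G (F x)) (nabla G F ('D_w F) v x) (nu a)
              * inner (G (F x)) (nabla G F ('D_z F) u x) (nu a)).
Proof.
have split_hess a b c d :
    inner (G (F x)) (nabla G F ('D_b F) a x) (nabla G F ('D_d F) c x) =
    inner (g x) (christoffel g x a b) (christoffel g x c d)
    + \sum_i inner (G (F x)) (nabla G F ('D_b F) a x) (nu i)
             * inner (G (F x)) (nabla G F ('D_d F) c x) (nu i).
  apply: (etrans (tangent_normal_inner _ _)); congr (_ + _).
  apply: (etrans _ (esym (orthonormal_inner _ _ erefl (g_sym Ux) e_orthonormal))).
  by apply: eq_bigr => i _; congr (_ * _); apply: nabla_derive_tangent.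
have solve (l r h h' c c' s s' : R) : l = r + h - h' - (c - c') ->
    h = c + s -> h' = c' + s' -> l = r + (s - s').
  by move=> -> -> ->; ring.
apply: (etrans (solve _ _ _ _ _ _ _ _ (gauss_equation u v w z Ux)
  (split_hess _ _ _ _) (split_hess _ _ _ _))).
by rewrite -sumrB.
Qed.

Let A a := shape_mx (g x) G F (nu a) x.

Lemma shape_mx_inner a u w :
  inner (g x) (u *m A a) w = inner (G (F x)) (nabla G F ('D_w F) u x) (nu a).
Proof.
have cw : differentiable (cst w : 'rV[R]_n -> 'rV[R]_n) x by apply: differentiable_cst.
apply: (shape_mxP u (g_unit Ux) (dG WFx) _ _ cw (nu_normal a)).
- by apply: filterS (near_U Ux) => y; apply: dF.
- by move=> v; apply: dDF.
Qed.

Let E : 'M[R]_n := \matrix_i e i.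
(** The matrix of [<A_a e_i, e_j>], similar to [A a] because [g x *m E^T] inverts [E]: traces are
    preserved and self-adjointness becomes symmetry. *)
Let B a := E *m A a *m g x *m E^T.
Let coord (u : 'rV[R]_n) := u *m g x *m E^T.

Let mul_rowE (C : 'M[R]_n) i j : (E *m C *m E^T) i j = (e i *m C *m (e j)^T) 0 0.
Proof.
rewrite -(rowK e i) -(rowK e j) -/E tr_row -row_mul [RHS]mxE [LHS]mxE.
by apply: eq_bigr => l _; rewrite !mxE.
Qed.

Let EgE : E *m (g x *m E^T) = 1%:M.
Proof.
by apply/matrixP => i j; rewrite mulmxA mul_rowE [RHS]mxE -e_orthonormal.
Qed.

Let gEE : g x *m E^T *m E = 1%:M. Proof. exact: mulmx1C. Qed.

Let coordE u : coord u *m E = u.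
Proof. by rewrite /coord -(mulmxA u) -mulmxA gEE mulmx1. Qed.

Let frame_shapeE a i j :
  B a i j = inner (G (F x)) (nabla G F ('D_(e j) F) (e i) x) (nu a).
Proof. by rewrite -shape_mx_inner /B -(mulmxA E) mul_rowE /inner mulmxA. Qed.

Lemma frame_shape_sym a : (B a)^T = B a.
Proof.
apply/matrixP => i j; rewrite mxE !frame_shapeE.
by have -> := nabla_derive_sym (e j) (e i) Ux.
Qed.

Lemma frame_shape_tr a : \tr (B a) = \tr (A a).
Proof.
rewrite /B -!mulmxA mxtrace_mulC -!mulmxA.
by rewrite (mulmxA (g x)) gEE mulmx1.
Qed.

Lemma frame_shape_tr2 a : \tr (B a *m B a) = \tr (A a *m A a).
Proof.
have -> : B a *m B a = E *m (A a *m (g x *m E^T *m E) *m A a *m (g x *m E^T)).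
  by rewrite /B !mulmxA.
by rewrite gEE mulmx1 mxtrace_mulC -(mulmxA (A a *m A a)) gEE mulmx1.
Qed.

Lemma dot_coord u v : dot (coord u) (coord v) = inner (g x) u v.
Proof.
have -> : dot (coord u) (coord v) = (u *m (g x *m E^T *m E) *m (g x *m v^T)) 0 0.
  by rewrite /dot /coord !trmx_mul trmxK (g_sym Ux) !mulmxA.
by rewrite gEE mulmx1 mulmxA.
Qed.

Lemma coord_frame_shape a u : coord u *m B a = coord (u *m A a).
Proof. by rewrite /B !mulmxA coordE. Qed.

Lemma coord_entry u i : coord u 0 i = inner (g x) u (e i).
Proof.
rewrite /coord /inner [LHS]mxE [RHS]mxE; apply: eq_bigr => l _.
by rewrite !mxE.
Qed.

(** Summing [gauss_normal] over the frame, the diagonal entries of [B a] add up to its trace, and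
    the mixed products become the squared components of the shape operator applied to [u], by
    symmetry of the second fundamental form. *)
Lemma ricci_gauss u :
  \sum_i (curvature_op g (cst u) (cst (delta_mx 0 i)) (cst u) x) 0 i =
  \sum_i inner (G (F x)) (curvature_op G (cst ('D_u F x)) (cst ('D_(e i) F x))
                            (cst ('D_u F x)) (F x)) ('D_(e i) F x)
  + \sum_a (\tr (B a) * dot (coord u *m B a) (coord u)
            - dot (coord u *m B a) (coord u *m B a)).
Proof.
have lin v := curvature_op_linear u v u U_open g_smooth g_unit Ux.
apply: (etrans (frame_trace e_orthonormal lin)).
apply: (etrans (eq_bigr _ (fun i _ => gauss_normal u (e i) u (e i)))).
rewrite big_split; congr (_ + _).
rewrite exchange_big; apply: eq_bigr => a _.
rewrite sumrB; congr (_ - _).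
  rewrite -mulr_sumr mulrC; congr (_ * _).
    by apply: eq_bigr => i _; rewrite frame_shapeE.
  by rewrite coord_frame_shape dot_coord shape_mx_inner.
rewrite coord_frame_shape /dot [RHS]mxE; apply: eq_bigr => i _.
have c : coord (u *m A a) 0 i = inner (G (F x)) (nabla G F ('D_(e i) F) u x) (nu a).
  exact: etrans (coord_entry _ _) (shape_mx_inner _ _ _).
have ct : (coord (u *m A a))^T i 0 = coord (u *m A a) 0 i by rewrite mxE.
have s : inner (G (F x)) (nabla G F ('D_u F) (e i) x) (nu a) =
    inner (G (F x)) (nabla G F ('D_(e i) F) u x) (nu a).
  by have -> := nabla_derive_sym (e i) u Ux.
have solve (p q r t : R) : p = q -> r = q -> t = q -> p * q = r * t.
  by move=> -> -> ->.
exact: solve s c (etrans ct c).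
Qed.

Lemma ricci_ge u (H : R) : (2 <= n)%N -> 0 <= H ->
  let S := \sum_a \tr (A a *m A a) in
  n%:R ^+ 2 * H ^+ 2 = \sum_a \tr (A a) ^+ 2 ->
  - ((n%:R - 1) / n%:R)
    * (S + n%:R * (n%:R - 2) / Num.sqrt (n%:R * (n%:R - 1))
             * H * Num.sqrt (S - n%:R * H ^+ 2)
         - 2 * n%:R * H ^+ 2)
    * inner (g x) u u
  + \sum_i inner (G (F x)) (curvature_op G (cst ('D_u F x)) (cst ('D_(e i) F x))
                              (cst ('D_u F x)) (F x)) ('D_(e i) F x)
  <= \sum_i (curvature_op g (cst u) (cst (delta_mx 0 i)) (cst u) x) 0 i.
Proof.
move=> n2 H0 S eH; rewrite ricci_gauss addrC lerD2l -dot_coord.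
apply: leung_inequality => //.
- exact: frame_shape_sym.
- by apply: eq_bigr => a _; rewrite frame_shape_tr2.
- by rewrite eH; apply: eq_bigr => a _; rewrite frame_shape_tr.
Qed.

End Frame.
End Gauss.

(** * Passage to charts *)

Lemma smooth_on_subset (R : realType) (V W : normedModType R) (D D' : set V)
    (f : V -> W) :
  D `<=` D' -> smooth_on D' f -> smooth_on D f.
Proof.
move=> sD sf k; have := sf k; elim: k f {sf} => [|k IH] f /=.
  by move=> h x /sD; apply: h.
by move=> [df h]; split=> [x /sD|v]; [apply: df | apply: IH].
Qed.

(** The image is the preimage of [D] under [bwd b] inside the open set [img b], where [bwd b] is
    continuous. *)
Lemma open_fwd_image (R : realType) (T : topologicalType) (n : nat)
    (b : chart R T n) (D : set T) :
  open D -> D `<=` dom b -> open (fwd b @` D).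
Proof.
move=> oD Db.
have -> : fwd b @` D = img b `&` bwd b @^-1` D.
  apply/seteqP; split=> [_ [q Dq <-]|y [iy Dy]].
    by split; [exact: fwd_img (Db _ Dq) | rewrite /= fwdK //; apply: Db].
  by exists (bwd b y) => //; apply: bwdK.
rewrite openE => y [iy Dy].
have cb := @bwd_continuous R T n b.
rewrite (continuous_open_subspace _ (@img_open R T n b)) in cb.
apply: filterI; first by apply: open_nbhs_nbhs; split=> //; apply: img_open.
by apply: cb; [rewrite inE | apply: open_nbhs_nbhs].
Qed.

Lemma orthonormal_sum_inner (R : realType) (k m : nat) (G : 'M[R]_m)
    (nu : 'I_k -> 'rV[R]_m) (T : 'I_k -> R) :
  (forall a a', inner G (nu a) (nu a') = (a == a')%:R) ->
  inner G (\sum_a T a *: nu a) (\sum_a T a *: nu a) = \sum_a T a ^+ 2.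
Proof.
move=> on; rewrite inner_suml; apply: eq_bigr => a _.
rewrite innerZl inner_sumr (bigD1 a) //= innerZr on eqxx mulr1 big1 ?addr0 //.
by move=> j ja; rewrite innerZr on eq_sym (negbTE ja) mulr0.
Qed.

Theorem lemma3p1 (R : realType) (n m : nat) (hn : (2 <= n)%N)
    (Sigma : riemannian R n) (M : riemannian R m) (f : Sigma -> M)
    (hf : isometric_immersion f)
    (X : chart R Sigma n -> Sigma -> 'rV[R]_n)
    (hX : vector_field [set: Sigma] X)
    (V : set Sigma) (hV : open V)
    (e : 'I_n -> chart R Sigma n -> Sigma -> 'rV[R]_n)
    (he : tangent_frame V e)
    (nu : 'I_(m - n) -> chart R M m -> Sigma -> 'rV[R]_m)
    (hnu : normal_frame f V nu)
    (p : Sigma) (hp : V p)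
    (b : chart R Sigma n) (hb : atlas b) (hbp : dom b p)
    (c : chart R M m) (hc : atlas c) (hcp : dom c (f p)) :
  let S := sqnorm_sff f nu b c p in
  let H := mean_curvature f nu b c p in
  let df := tangent_map f b c p in
  ricci b p (X b p) (X b p) >=
    - ((n%:R - 1) / n%:R)
      * (S + n%:R * (n%:R - 2) / Num.sqrt (n%:R * (n%:R - 1))
               * H * Num.sqrt (S - n%:R * H ^+ 2)
           - 2 * n%:R * H ^+ 2)
      * inner (metric b p) (X b p) (X b p)
    + \sum_(i < n) inner (metric c (f p))
        (curvature c (f p) (df (X b p)) (df (e i b p)) (df (X b p)))
        (df (e i b p)).
Proof.
case: hf => -[cf sf] _ isof; case: he => _ oe; case: hnu => _ nnu onu.
cbv zeta; set H := mean_curvature f nu b c p.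
(* The coordinate domain on which [smooth_map] provides smoothness of [in_charts f b c]; continuity
   of [f] makes it open. *)
pose U := fwd b @` (dom b `&` f @^-1` dom c).
pose F := in_charts f b c; pose x := fwd b p.
have oU : open U.
  apply: open_fwd_image; last by move=> q [].
  by apply: openI; [exact: dom_open | apply: open_comp; [move=> q _; exact: cf | exact: dom_open]].
have Ux : U x by exists p.
have FE q : dom b q -> F (fwd b q) = fwd c (f q).
  by move=> bq; rewrite /F /in_charts /= fwdK.
have Uimg y : U y -> img b y by move=> [q [bq _] <-]; apply: fwd_img.
have FW y : U y -> img c (F y).
  by move=> [q [bq cq] <-]; rewrite FE //; apply: fwd_img.
have sg : smooth_on U (metric_in b).
  by apply: smooth_on_subset (metric_smooth hb).
have sG : smooth_on (img c) (metric_in c) := metric_smooth hc.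
have gsym y : U y -> (metric_in b y)^T = metric_in b y.
  by move=> /Uimg iy; exact: (Defs.metric_sym hb (bwd_dom iy)).
have Gsym y : img c y -> (metric_in c y)^T = metric_in c y.
  by move=> iy; exact: (Defs.metric_sym hc (bwd_dom iy)).
have gpos y u : U y -> u != 0 -> 0 < inner (metric_in b y) u u.
  by move=> /Uimg iy; exact: (Defs.metric_pos hb (bwd_dom iy)).
have Gpos y u : img c y -> u != 0 -> 0 < inner (metric_in c y) u u.
  by move=> iy; exact: (Defs.metric_pos hc (bwd_dom iy)).
have gE q : dom b q -> metric_in b (fwd b q) = metric b q.
  by move=> bq; rewrite /metric_in /= fwdK.
have GE q : dom b q -> dom c (f q) -> metric_in c (F (fwd b q)) = metric c (f q).
  by move=> bq cq; rewrite FE // /metric_in /= fwdK.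
have iso y u v : U y ->
    inner (metric_in c (F y)) ('D_u F y) ('D_v F y) = inner (metric_in b y) u v.
  by move=> [q [bq cq] <-]; rewrite GE // gE //; apply: isof.
have oe' i j : inner (metric_in b x) (e i b p) (e j b p) = (i == j)%:R.
  by rewrite gE //; apply: oe.
have nnu' a u : inner (metric_in c (F x)) ('D_u F x) (nu a c p) = 0.
  by rewrite GE //; apply: nnu.
have onu' a a' : inner (metric_in c (F x)) (nu a c p) (nu a' c p) = (a == a')%:R.
  by rewrite GE //; apply: onu.
(* Pythagoras in the normal frame gives the squared length of the mean curvature vector; it is
   nonnegative, so squaring undoes the square root in [H]. *)
have H2 : n%:R ^+ 2 * H ^+ 2 = \sum_a \tr (shape_operator f nu b c p a) ^+ 2.
  have n0 : n%:R != 0 :> R by rewrite pnatr_eq0 -lt0n (ltn_trans _ hn).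
  have e2 : inner (metric c (f p)) (mean_curvature_vector f nu b c p)
      (mean_curvature_vector f nu b c p) =
      n%:R^-1 ^+ 2 * \sum_a \tr (shape_operator f nu b c p a) ^+ 2.
    rewrite /mean_curvature_vector innerZl innerZr orthonormal_sum_inner ?mulrA //.
    by move=> a a'; apply: onu.
  rewrite /H /mean_curvature sqr_sqrtr e2.
    by rewrite mulrA -exprMn mulfV // expr1n mul1r.
  by rewrite mulr_ge0 ?sqr_ge0 // sumr_ge0 // => a _; apply: sqr_ge0.
have H0 : 0 <= H by apply: sqrtr_ge0.
have := @ricci_ge R n m U (img c) F (metric_in b) (metric_in c) oU (@img_open _ _ _ c)
  (sf b c hb hc) FW sg sG gsym Gsym gpos Gpos iso x (fun i => e i b p) (m - n)
  (fun a => nu a c p) Ux (fun h => subnKC h) oe' nnu' onu' (X b p) H hn H0.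
rewrite /x gE // GE // FE //.
by apply.
Qed.
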